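(* There are absolute constants $C,C'>0$ such that the following holds. Let $X=(\xi_1,\dots,\xi_n)$ be a random vector in $\mathbb{C}^n$ whose coordinates $\xi_i$ are independent random variables with mean $0$ and variance $1$. Let $K>1$, put $\xi_i'=\xi_i\mathbf{1}_{|\xi_i|\le K}$, let $\mu_i$ and $\sigma_i^2$ be the mean and variance of $\xi_i'$, and set $$\varepsilon_1=\max_{1\le i\le n}\mathbf{P}(|\xi_i|>K),\qquad \varepsilon_2=\max_{1\le i\le n}|\mu_i|,\qquad \varepsilon_3=\max_{1\le i\le n}|\sigma_i^2-1|.$$ Assume $\varepsilon_1,\varepsilon_2,\varepsilon_3\le 1/2$. Let $H\subset\mathbb{C}^n$ be a subspace of dimension $d$ with orthonormal basis $\{u_1,\dots,u_d\}$. Then for any real numbers $c_1,\dots,c_d\in[0,1]$ and any $t>0$, $$\mathbf{P}\left(\left|\sqrt{\sum_{j=1}^d c_j|u_j^*X|^2}-\sqrt{\sum_{j=1}^d c_j}\right|\ge t+4n^2K^2(\varepsilon_2+\varepsilon_3)\right)\le C\exp\left(-C'\frac{t^2}{K^2}\right)+n\varepsilon_1.$$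
   Context: For a complex random variable $\xi$ with mean $\mu$, its variance is $\mathbf{E}|\xi-\mu|^2$. $\mathbf{1}_{E}$ denotes the indicator of the event $E$. *)

(* Defs.v *)
From HB Require Import structures.
From mathcomp Require Import all_boot all_order all_algebra.
From mathcomp Require Import sesquilinear spectral complex.
From mathcomp Require Import all_classical all_reals all_analysis.
Set Implicit Arguments.
Unset Strict Implicit.
Unset Printing Implicit Defensive.
Import Order.TTheory GRing.Theory Num.Theory.
Import numFieldNormedType.Exports.

Local Open Scope classical_set_scope.
Local Open Scope complex_scope.
Local Open Scope ring_scope.
Local Open Scope sesquilinear_scope.

(* Since `|z| lives in R[i] itself, the real-valued modulus is normc. *)
Notation normc := ComplexField.Normc.normc.

(* C carries the Borel sigma-algebra of R^2, transported along
   z |-> (Re z, Im z). *)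
Section complex_measurable.
Context {R : realType}.

Definition ReIm (z : R[i]) : R * R := (complex.Re z, complex.Im z).

Definition complex_measurable : set (set R[i]) :=
  preimage_set_system setT ReIm measurable.

Let complex_measurable_sigma_algebra : sigma_algebra setT complex_measurable.
Proof. by apply: sigma_algebra_preimage; exact: sigma_algebra_measurable. Qed.

Let complex_measurable0 : complex_measurable set0.
Proof. by case: complex_measurable_sigma_algebra. Qed.

Let complex_measurableC (A : set R[i]) :
  complex_measurable A -> complex_measurable (~` A).
Proof.
by rewrite -setTD; case: complex_measurable_sigma_algebra => _ + _; apply.
Qed.

Let complex_measurable_bigcup (F : (set R[i])^nat) :
  (forall i, complex_measurable (F i)) -> complex_measurable (\bigcup_i F i).
Proof. by case: complex_measurable_sigma_algebra => _ _; apply. Qed.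

HB.instance Definition _ := isPointed.Build R[i] 0.

HB.instance Definition _ := isMeasurable.Build default_measure_display R[i]
  complex_measurable0 complex_measurableC complex_measurable_bigcup.

End complex_measurable.

Section complex_random_variables.
Context d (T : measurableType d) (R : realType) (P : probability T R).

Definition cintegrable (X : T -> R[i]) : Prop :=
  P.-integrable setT (fun w => (complex.Re (X w))%:E) /\
  P.-integrable setT (fun w => (complex.Im (X w))%:E).

(* fine makes this a junk value unless cintegrable X. *)
Definition cmean (X : T -> R[i]) : R[i] :=
  fine 'E_P[fun w => complex.Re (X w)] +i* fine 'E_P[fun w => complex.Im (X w)].

Definition cvariance (X : T -> R[i]) : \bar R :=
  'E_P[fun w => normc (X w - cmean X) ^+ 2].

Definition ctruncate (K : R) (X : T -> R[i]) (w : T) : R[i] :=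
  X w * (\1_[set v | normc (X v) <= K] w)%:C.

Definition mutually_independent (n : nat) (X : 'I_n -> T -> R[i]) : Prop :=
  forall (J : {set 'I_n}) (B : 'I_n -> set R[i]),
    (forall i, measurable (B i)) ->
    P (\bigcap_(i in [set` J]) (X i @^-1` B i)) =
    (\prod_(i in J) P (X i @^-1` B i))%E.

End complex_random_variables.

Section truncation_errors.
Context d (T : measurableType d) (R : realType) (P : probability T R).
Variables (n : nat) (K : R) (X : 'I_n -> T -> R[i]).

(* All maximised quantities are nonnegative, so starting from 0 changes nothing
   for n > 0. *)
Definition eps1 : R :=
  \big[Num.max/0]_(i < n) fine (P [set w | K < normc (X i w)]).

Definition eps2 : R :=
  \big[Num.max/0]_(i < n) normc (cmean P (ctruncate K (X i))).

Definition eps3 : R :=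
  \big[Num.max/0]_(i < n) `|fine (cvariance P (ctruncate K (X i))) - 1|.

End truncation_errors.

Definition random_vector (T : Type) (R : realType) (n : nat)
  (X : 'I_n -> T -> R[i]) (w : T) : 'cV[R[i]]_n := \col_i X i w.

Definition hdot (R : realType) (n : nat) (u v : 'cV[R[i]]_n) : R[i] :=
  (u^t* *m v) 0 0.

Definition orthonormal_basis (R : realType) (n d : nat)
  (H : {vspace 'cV[R[i]]_n}) (u : d.-tuple 'cV[R[i]]_n) : Prop :=
  basis_of H u /\
  forall j k : 'I_d, hdot (tnth u j) (tnth u k) = (j == k)%:R.

(* Main.v *)
Require Import Defs.
From HB Require Import structures.
From mathcomp Require Import all_boot all_order all_algebra.
From mathcomp Require Import complex ring lra.
From mathcomp Require Import all_classical all_reals all_analysis.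
From mathcomp Require Import measurable_realfun.

(** The quantity sqrt(sum_j c_j |u_j^* X|^2) is a seminorm f of X. By Bessel's
    inequality and c_j <= 1 it is dominated by the Euclidean norm, so it is a
    convex 1-Lipschitz function. Convex Lipschitz functions of independent
    coordinates lying in sets of diameter D have Gaussian concentration at scale
    D, whatever the dimension. Three things remain: to pass from X to
    coordinates that are bounded (and, for convenience, finitely valued), to
    see that f concentrates around its quadratic mean, and to compare that
    quadratic mean with sqrt(sum_j c_j).

    Concentration comes from Maurey's property (tau). Let Q f be the
    infimum-convolution of f with the cost |s|^2 / (16 D^2). For f convex and
    nonnegative one has E exp(Q f) * E exp(- f) <= 1: [tau_single] proves this
    for one coordinate, from a scalar inequality, and [tau_product] for a
    product, by induction on the coordinates. If f is 1-Lipschitz then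
    Q(r f) >= r f - 4 r^2 D^2, so that
    E exp(r f) * E exp(- r f) <= exp(4 r^2 D^2). Jensen's inequality turns this
    single bound into bounds on both exponential moments around the mean, hence
    into a two-sided tail and a variance of order D^2. The variance bound lets
    the mean be replaced by the quadratic mean: [concentration_L2].

    By independence and orthonormality, the square of the quadratic mean of f
    equals sum_j c_j (|u_j^* mu|^2 + sum_i |u_ij|^2 sigma_i^2), which gives
    [sqrt_prodE_sqr_wnorm]: the quadratic mean is within
    n (max |mu_i| + max |sigma_i^2 - 1|) of sqrt(sum_j c_j).

    Finally each truncated coordinate is rounded to a fine grid in the square of
    side 2 K. The rounded vector has finitely many values, and independence
    gives these values product weights, so everything above concerns finite
    sums only. Rounding with step eta moves f, the means and the variances by
    O(n K eta), which a slack of 1 absorbs. The event that truncation changes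
    some coordinate has probability at most n eps_1. For t <= 64 K the claim is
    trivial since the right-hand side then exceeds 1; for larger t the additive
    errors of order K are smaller than t ([large_deviation_bound]). *)

Set Implicit Arguments.
Unset Strict Implicit.
Unset Printing Implicit Defensive.
Import Order.TTheory GRing.Theory Num.Theory.
Import numFieldNormedType.Exports.

Local Open Scope classical_set_scope.
Local Open Scope complex_scope.
Local Open Scope ring_scope.

(** * A scalar exponential inequality *)

Section ScalarInequality.
Variable R : realType.
Implicit Types F x : R.

Lemma expRN_le_quadratic F : 0 <= F ->
  expR (- F) <= 1 - F + 3 / 4 * F ^+ 2.
Proof.
move=> F0; rewrite expRN.
have h : 1 + F + F ^+ 2 / 4 <= expR F.
  have := expR_ge1Dx (F / 2) => h1.
  have -> : expR F = expR (F / 2) ^+ 2 by rewrite expr2 -expRD; congr expR; field.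
  have -> : 1 + F + F ^+ 2 / 4 = (1 + F / 2) ^+ 2 by field.
  by rewrite lerXn2r // nnegrE; lra.
have h0 : 0 < 1 + F + F ^+ 2 / 4 by nra.
apply: (@le_trans _ _ (1 + F + F ^+ 2 / 4)^-1).
  by rewrite lef_pV2// posrE expR_gt0.
rewrite -(ler_pM2l h0) divff ?gt_eqF//.
have := sqr_ge0 F; have : 0 <= F ^+ 3 by rewrite exprn_ge0.
have : 0 <= F ^+ 4 by rewrite exprn_ge0.
by rewrite !exprS expr0 => *; nra.
Qed.

Lemma expR_le_invB x : x < 1 -> expR x <= (1 - x)^-1.
Proof.
move=> x1; have h := expR_ge1Dx (- x).
rewrite -[x in expR x]opprK expRN lef_pV2 ?posrE ?expR_gt0//; lra.
Qed.

(** Moving a fraction t of the way from a point where f exceeds its minimum by F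
    towards a minimiser costs at most t^2 / 16 and leaves an excess (1 - t) F.
    The choice t = min(1, 8 F) minimises the total; for small F it yields
    F - 4 F^2, and the quadratic gain is what beats exp(- F) + exp(F) > 2. *)
Lemma expR_transport_le2 F : 0 <= F -> exists2 t : R, 0 <= t <= 1 &
  expR ((1 - t) * F + t ^+ 2 / 16) + expR (- F) <= 2.
Proof.
move=> F0; have [F1|F1] := leP F (1 / 8).
- exists (8 * F); first by apply/andP; split; lra.
  have -> : (1 - 8 * F) * F + (8 * F) ^+ 2 / 16 = F - 4 * F ^+ 2 by field.
  have := expRN_le_quadratic F0.
  have : expR (F - 4 * F ^+ 2) <= (1 - (F - 4 * F ^+ 2))^-1.
    by apply: expR_le_invB; nra.
  have h0 : 0 < 1 - (F - 4 * F ^+ 2) by nra.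
  suff : (1 - (F - 4 * F ^+ 2))^-1 <= 1 + F - 3 / 4 * F ^+ 2 by lra.
  rewrite -(ler_pM2l h0) divff ?gt_eqF//.
  have : 0 <= F ^+ 2 by rewrite exprn_ge0.
  have : 0 <= F ^+ 3 by rewrite exprn_ge0.
  have : F ^+ 4 <= F ^+ 2 by rewrite ler_wiXn2l //; lra.
  by rewrite !exprS expr0 => *; nra.
- exists 1; first by rewrite ler01 lexx.
  rewrite subrr mul0r add0r expr1n.
  have h1 : expR (1 / 16 : R) <= 16 / 15.
    apply: le_trans (expR_le_invB _) _; first by lra.
    have -> : 1 - 1 / 16 = 15 / 16 :> R by field.
    by rewrite invf_div.
  have h2 : expR (- F) <= 8 / 9.
    rewrite expRN -[8 / 9]invf_div lef_pV2 ?posrE ?expR_gt0 ?divr_gt0//.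
    by have := expR_ge1Dx F; lra.
  lra.
Qed.
End ScalarInequality.

(** * Infimum-convolution and property (tau) for one coordinate *)

Section InfConvolution.
Variables (R : realType) (V : lmodType R[i]).
Implicit Types (f : V -> R) (b x y : V) (k t : R) (s : R[i]).

Lemma normcD_le s s' : normc (s + s') <= normc s + normc s'.
Proof. exact: le_normcD. Qed.

Lemma normc_opp s : normc (- s) = normc s.
Proof. exact: normcN. Qed.

Lemma normc_distC s s' : normc (s - s') = normc (s' - s).
Proof. by rewrite -normc_opp opprB. Qed.

Lemma normcB_le s s' : normc (s - s') <= normc s + normc s'.
Proof. by apply: le_trans (normcD_le _ _) _; rewrite normc_opp. Qed.

Lemma normc_ge0 s : 0 <= normc s.
Proof. by case: s => a c; exact: sqrtr_ge0. Qed.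

Lemma normc_real t : normc t%:C = `|t|.
Proof. by rewrite /= expr0n addr0 sqrtr_sqr. Qed.

Lemma sqr_normc_convex s s' t : 0 <= t <= 1 ->
  normc (t%:C * s + (1 - t)%:C * s') ^+ 2 <=
  t * normc s ^+ 2 + (1 - t) * normc s' ^+ 2.
Proof.
move=> /andP[t0 t1].
have := normcD_le (t%:C * s) ((1 - t)%:C * s').
rewrite !ComplexField.Normc.normcM !normc_real !ger0_norm ?subr_ge0// => h.
have := normc_ge0 s; have := normc_ge0 s'.
have := normc_ge0 (t%:C * s + (1 - t)%:C * s').
move: h; set u := normc _; set v := normc s; set w := normc s'.
move=> h u0 w0 v0.
apply: (@le_trans _ _ ((t * v + (1 - t) * w) ^+ 2)).
  by rewrite lerXn2r// nnegrE addr_ge0 ?mulr_ge0 ?subr_ge0.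
rewrite -subr_ge0.
have -> : t * v ^+ 2 + (1 - t) * w ^+ 2 - (t * v + (1 - t) * w) ^+ 2 =
  t * (1 - t) * (v - w) ^+ 2 by ring.
by rewrite mulr_ge0 ?sqr_ge0// mulr_ge0 ?subr_ge0.
Qed.

Lemma cost_ge0 k s : 0 <= k -> 0 <= k * normc s ^+ 2.
Proof. by move=> k0; rewrite mulr_ge0 ?exprn_ge0 ?normc_ge0. Qed.

(** Convexity along real segments of a complex vector space; the scalars are
    embedded in the complex numbers. *)
Definition convex_fct f := forall x y t, 0 <= t <= 1 ->
  f (t%:C *: x + (1 - t)%:C *: y) <= t * f x + (1 - t) * f y.

Definition infconv k b f x : R :=
  inf [set f (x + s *: b) + k * normc s ^+ 2 | s in [set: R[i]]].

Lemma infconv_le k b f x s : 0 <= k -> (forall y, 0 <= f y) ->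
  infconv k b f x <= f (x + s *: b) + k * normc s ^+ 2.
Proof.
move=> k0 f0; apply: ge_inf; last by exists s.
by exists 0 => _ [u _ <-]; rewrite addr_ge0 ?cost_ge0.
Qed.

Lemma infconv_ge k b f x B :
  (forall s, B <= f (x + s *: b) + k * normc s ^+ 2) -> B <= infconv k b f x.
Proof.
move=> hB; apply: lb_le_inf; first by eexists; exists 0.
by move=> _ [u _ <-].
Qed.

Lemma infconv_ge0 k b f x : 0 <= k -> (forall y, 0 <= f y) ->
  0 <= infconv k b f x.
Proof.
by move=> k0 f0; apply: infconv_ge => s; rewrite addr_ge0 ?cost_ge0.
Qed.

Lemma infconv_ge_affine k b f x B t c : 0 <= t ->
  (forall s, B <= t * (f (x + s *: b) + k * normc s ^+ 2) + c) ->
  B <= t * infconv k b f x + c.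
Proof.
rewrite le_eqVlt => /predU1P[<- /(_ 0)|t0 hB]; first by rewrite !mul0r.
rewrite -lerBlDr mulrC -ler_pdivrMr//; apply: infconv_ge => s.
by rewrite ler_pdivrMr// lerBlDr mulrC.
Qed.

(** The infimum over s of a jointly convex function of (x, s) is convex. This is
    why the competitor s ranges over the whole complex plane and not only over
    displacements between points of the support. *)
Lemma infconv_convex k b f : 0 <= k -> (forall y, 0 <= f y) ->
  convex_fct f -> convex_fct (infconv k b f).
Proof.
move=> k0 f0 cf x y t t01; have /andP[t0 t1] := t01.
apply: infconv_ge_affine => // s.
rewrite [leRHS]addrC; apply: infconv_ge_affine; first by rewrite subr_ge0.
move=> s'.
apply: (le_trans (infconv_le _ _ (t%:C * s + (1 - t)%:C * s') k0 f0)).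
have -> : t%:C *: x + (1 - t)%:C *: y + (t%:C * s + (1 - t)%:C * s') *: b =
    t%:C *: (x + s *: b) + (1 - t)%:C *: (y + s' *: b).
  by rewrite scalerDl !scalerDr !scalerA addrACA.
have := cf (x + s *: b) (y + s' *: b) t t01.
have := ler_wpM2l k0 (sqr_normc_convex s s' t01).
by move=> *; lra.
Qed.

(** Only competitors on the segment from a point of the support to a minimiser
    of f on the support are used. With m the minimum and F the excess over m,
    they give exp(Q f) <= exp(m) (2 - exp(- F)) pointwise, so the product of
    the two averages is at most (2 - s) s <= 1 where s is the average of
    exp(- F). *)
Lemma tau_single (I : finType) (p : I -> R) (z : I -> R[i]) (D : R) f b x :
  (forall a, 0 <= p a) -> \sum_a p a = 1 -> 0 < D ->
  (forall a a', normc (z a - z a') <= D) ->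
  (forall y, 0 <= f y) -> convex_fct f ->
  (\sum_a p a * expR (infconv (16 * D ^+ 2)^-1 b f (x + z a *: b))) *
  (\sum_a p a * expR (- f (x + z a *: b))) <= 1.
Proof.
move=> p0 p1 D0 zD f0 cf.
have [a0 _|I0] := pickP (@predT I); last first.
  by move: p1; rewrite big_pred0// => /eqP; rewrite eq_sym oner_eq0.
pose g a := f (x + z a *: b).
have [am _ gm] := @arg_minP _ R I a0 predT g isT.
set m := g am; set k := (16 * D ^+ 2)^-1.
have k0 : 0 <= k by rewrite invr_ge0 mulr_ge0 ?sqr_ge0.
have ub a : expR (infconv k b f (x + z a *: b)) <=
    expR m * (2 - expR (- (g a - m))).
  have F0 : 0 <= g a - m by rewrite subr_ge0 gm.
  have [t t01 ht] := expR_transport_le2 F0; have /andP[t0 t1] := t01.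
  apply: (@le_trans _ _ (expR (m + ((1 - t) * (g a - m) + t ^+ 2 / 16)))).
    rewrite ler_expR.
    apply: (le_trans (infconv_le _ _ (t%:C * (z am - z a)) k0 f0)).
    have -> : x + z a *: b + (t%:C * (z am - z a)) *: b =
        t%:C *: (x + z am *: b) + (1 - t)%:C *: (x + z a *: b).
      rewrite rmorphB rmorph1 scalerBl scale1r -[RHS]addrCA; congr (_ + _).
      by rewrite -scalerBr -scalerA scalerBl opprD addrACA subrr add0r.
    have := cf (x + z am *: b) (x + z a *: b) t t01.
    rewrite -[f (x + z am *: b)]/m -[f (x + z a *: b)]/(g a) => h.
    suff : k * normc (t%:C * (z am - z a)) ^+ 2 <= t ^+ 2 / 16 by lra.
    rewrite ComplexField.Normc.normcM normc_real ger0_norm// exprMn.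
    rewrite mulrCA ler_wpM2l ?sqr_ge0// /k mulrC ler_pdivrMr; last first.
      by rewrite mulr_gt0// exprn_gt0.
    rewrite mulrA mulVf// mul1r lerXn2r ?nnegrE ?normc_ge0 ?zD//.
    exact: ltW.
  rewrite expRD ler_wpM2l ?expR_ge0//; lra.
set S1 := \sum_a _; set S2 := \sum_a p a * expR (- f _).
set s := \sum_a p a * expR (- (g a - m)).
have -> : S2 = expR (- m) * s.
  rewrite mulr_sumr; apply: eq_bigr => a _; rewrite mulrCA -expRD.
  by congr (_ * expR _); rewrite /g; ring.
have s0 : 0 <= s by apply: sumr_ge0 => a _; rewrite mulr_ge0 ?expR_ge0.
have hS1 : S1 <= expR m * (2 - s).
  apply: (@le_trans _ _ (\sum_a p a * (expR m * (2 - expR (- (g a - m)))))).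
    by apply: ler_sum => a _; rewrite ler_wpM2l.
  have -> : expR m * (2 - s) = expR m * (2 * \sum_a p a - s) by rewrite p1 mulr1.
  rewrite mulr_sumr -sumrB mulr_sumr.
  suff -> : \sum_a p a * (expR m * (2 - expR (- (g a - m)))) =
    \sum_a expR m * (2 * p a - p a * expR (- (g a - m))) by [].
  by apply: eq_bigr => a _; ring.
apply: (@le_trans _ _ (expR m * (2 - s) * (expR (- m) * s))).
  by rewrite ler_wpM2r// mulr_ge0 ?expR_ge0.
rewrite mulrACA -expRD subrr expR0 mul1r.
by have := sqr_ge0 (s - 1); nra.
Qed.

End InfConvolution.

(** * Finite product measures *)

Lemma expR_convex_comb (R : realType) (x y t : R) : 0 <= t <= 1 ->
  expR (t * x + (1 - t) * y) <= t * expR x + (1 - t) * expR y.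
Proof.
move=> /andP[t0 t1].
have tangent (m u : R) : expR m * (1 + (u - m)) <= expR u.
  rewrite -[in leRHS](subrKC m u) expRD ler_wpM2l ?expR_ge0//.
  exact: expR_ge1Dx.
set m := t * x + (1 - t) * y.
have hx := ler_wpM2l t0 (tangent m x).
have t1' : 0 <= 1 - t by rewrite subr_ge0.
have hy := ler_wpM2l t1' (tangent m y).
apply: le_trans (lerD hx hy).
suff -> : t * (expR m * (1 + (x - m))) + (1 - t) * (expR m * (1 + (y - m))) =
  expR m by [].
by rewrite /m; ring.
Qed.

Section ProductExpectation.
Variables (R : realType) (J I : finType) (p : J -> I -> R).
Hypothesis p_ge0 : forall j a, 0 <= p j a.
Hypothesis p_sum1 : forall j, \sum_a p j a = 1.
Implicit Types (w : {ffun J -> I}) (g h : {ffun J -> I} -> R) (j : J) (a : I).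

Definition prodw w : R := \prod_j p j (w j).

Definition prodE g : R := \sum_w prodw w * g w.

Definition upd w j a : {ffun J -> I} := [ffun i => if i == j then a else w i].

Lemma prodw_ge0 w : 0 <= prodw w.
Proof. exact: prodr_ge0. Qed.

Lemma prodw_sum1 : \sum_w prodw w = 1.
Proof.
rewrite /prodw -(bigA_distr_bigA (fun j a => p j a)).
by rewrite big1.
Qed.

Lemma prodE_cst c : prodE (fun=> c) = c.
Proof. by rewrite /prodE -mulr_suml prodw_sum1 mul1r. Qed.

Lemma prodED g h : prodE (fun w => g w + h w) = prodE g + prodE h.
Proof. by rewrite -big_split; apply: eq_bigr => w _; rewrite mulrDr. Qed.

Lemma prodEZ c g : prodE (fun w => c * g w) = c * prodE g.
Proof. by rewrite mulr_sumr; apply: eq_bigr => w _; rewrite mulrCA. Qed.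

Lemma prodE_sum (A : Type) (r : seq A) (g : A -> {ffun J -> I} -> R) :
  prodE (fun w => \sum_(i <- r) g i w) = \sum_(i <- r) prodE (g i).
Proof. by rewrite exchange_big; apply: eq_bigr => w _; rewrite mulr_sumr. Qed.

Lemma le_prodE g h : (forall w, g w <= h w) -> prodE g <= prodE h.
Proof. by move=> gh; apply: ler_sum => w _; rewrite ler_wpM2l ?prodw_ge0. Qed.

Lemma prodE_ge0 g : (forall w, 0 <= g w) -> 0 <= prodE g.
Proof. by move=> g0; rewrite -(prodE_cst 0); exact: le_prodE. Qed.

Lemma eq_prodE g h : g =1 h -> prodE g = prodE h.
Proof. by move=> gh; apply: eq_bigr => w _; rewrite gh. Qed.

Lemma prodw_upd w j a : p j (w j) * prodw (upd w j a) = p j a * prodw w.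
Proof.
rewrite /prodw (bigD1 j)//= [in RHS](bigD1 j)//= ffunE eqxx mulrCA.
congr (_ * (_ * _)); apply: eq_bigr => i /negbTE ij.
by rewrite ffunE ij.
Qed.

(** Independence of coordinate j from the others, in the form needed here:
    coordinate j can be averaged separately. On pairs (a, w), exchanging a with
    the j-th entry of w is an involution that preserves the product weight,
    which makes the two sides the same sum. *)
Lemma prodE_resample j (h : I -> {ffun J -> I} -> R) :
  (forall a b w, h a (upd w j b) = h a w) ->
  prodE (fun w => h (w j) w) = \sum_a p j a * prodE (h a).
Proof.
move=> hupd.
transitivity (\sum_(x : I * {ffun J -> I})
    p j x.1 * (prodw x.2 * h x.1 x.2)); last first.
  rewrite -(pair_bigA _ (fun a w => p j a * (prodw w * h a w))) /=.
  by apply: eq_bigr => a _; rewrite mulr_sumr.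
pose swap (x : I * {ffun J -> I}) := (x.2 j, upd x.2 j x.1).
have swapK : involutive swap.
  case=> a w; rewrite /swap /= ffunE eqxx; congr (_, _).
  by apply/ffunP => i; rewrite !ffunE; case: eqP => // ->.
rewrite (reindex_inj (inv_inj swapK)) /=.
rewrite -(pair_bigA _ (fun a w =>
  p j (w j) * (prodw (upd w j a) * h (w j) (upd w j a)))) exchange_big /=.
apply: eq_bigr => w _.
under [RHS]eq_bigr do rewrite mulrA prodw_upd hupd -mulrA.
by rewrite -mulr_suml p_sum1 mul1r.
Qed.

Lemma prodE_expR_gt0 g : 0 < prodE (fun w => expR (g w)).
Proof.
rewrite lt_neqAle prodE_ge0 ?andbT; last by move=> w; exact: expR_ge0.
apply/eqP => /esym /psumr_eq0P h; have /eqP := prodw_sum1.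
rewrite big1 ?(eq_sym 0) ?oner_eq0// => w _.
have /eqP := h (fun w _ => mulr_ge0 (prodw_ge0 w) (expR_ge0 _)) w isT.
by rewrite mulf_eq0 (gt_eqF (expR_gt0 _)) orbF => /eqP.
Qed.

Lemma expR_ln_prodE g : expR (ln (prodE (fun w => expR (g w)))) =
  prodE (fun w => expR (g w)).
Proof. by rewrite lnK// posrE prodE_expR_gt0. Qed.

(** Convexity of the log-Laplace transform, i.e. Hoelder's inequality. After
    normalising both exponential averages to 1 it follows from convexity of the
    exponential. *)
Lemma ln_prodE_expR_convex g h (t : R) : 0 <= t <= 1 ->
  ln (prodE (fun w => expR (t * g w + (1 - t) * h w))) <=
  t * ln (prodE (fun w => expR (g w))) +
  (1 - t) * ln (prodE (fun w => expR (h w))).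
Proof.
move=> t01; rewrite -ler_expR expR_ln_prodE.
set A := ln (prodE (fun w => expR (g w))).
set B := ln (prodE (fun w => expR (h w))).
have EA : prodE (fun w => expR (g w)) = expR A by rewrite expR_ln_prodE.
have EB : prodE (fun w => expR (h w)) = expR B by rewrite expR_ln_prodE.
move: A B EA EB => A B EA EB.
have -> : expR (t * A + (1 - t) * B) = expR (t * A + (1 - t) * B) *
    prodE (fun w => t * (expR (- A) * expR (g w)) +
                    (1 - t) * (expR (- B) * expR (h w))).
  rewrite prodED (prodEZ t (fun w => _ * expR (g w))).
  rewrite (prodEZ (1 - t) (fun w => _ * expR (h w))).
  rewrite (prodEZ (expR (- A)) (fun w => expR (g w))) EA.
  rewrite (prodEZ (expR (- B)) (fun w => expR (h w))) EB.
  by rewrite !expRN !mulVf ?gt_eqF ?expR_gt0// !mulr1 subrKC mulr1.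
rewrite -prodEZ; apply: le_prodE => w.
move: (g w) (h w) A B {EA EB} => u v A B.
rewrite -[expR (- A) * _]expRD -[expR (- B) * _]expRD.
have -> : t * u + (1 - t) * v =
    t * A + (1 - t) * B + (t * (- A + u) + (1 - t) * (- B + v)) by ring.
by rewrite [leLHS]expRD ler_wpM2l ?expR_ge0// expR_convex_comb.
Qed.

End ProductExpectation.

(** * Property (tau) for products *)

Section TauProduct.
Variables (R : realType) (V : lmodType R[i]) (J I : finType).
Variables (p : J -> I -> R) (z : J -> I -> R[i]) (b : J -> V) (D : R).
Hypothesis p_ge0 : forall j a, 0 <= p j a.
Hypothesis p_sum1 : forall j, \sum_a p j a = 1.
Hypothesis D_gt0 : 0 < D.
Hypothesis z_diam : forall j a a', normc (z j a - z j a') <= D.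

Local Notation k := (16 * D ^+ 2)^-1.

(** Infimum-convolution in the coordinates of l, one after the other; in the
    end l enumerates all coordinates. *)
Definition infconvs (l : seq J) (f : V -> R) : V -> R :=
  foldr (fun j => infconv k (b j)) f l.

Let k_ge0 : 0 <= k.
Proof. by rewrite invr_ge0 mulr_ge0 ?exprn_ge0 ?ltW. Qed.

Lemma infconvs_ge0 l f : (forall x, 0 <= f x) -> forall x, 0 <= infconvs l f x.
Proof. by move=> f0; elim: l => //= j l IH x; exact: infconv_ge0. Qed.

Lemma infconvs_convex l f : (forall x, 0 <= f x) -> convex_fct f ->
  convex_fct (infconvs l f).
Proof.
move=> f0 cf; elim: l => //= j l IH; apply: infconv_convex => //.
exact: infconvs_ge0.
Qed.

(** Maurey's tensorisation. For the list j :: l, let g(x) be the logarithm of the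
    average over l of exp(Q_l f). It is nonnegative, and convex by
    [ln_prodE_expR_convex] because Q_l f is convex, so the one-coordinate
    inequality applies to g in direction j. The average of exp(Q_j Q_l f) is at
    most exp(Q_j g) by minimising after averaging, and the average of exp(- f)
    is at most exp(- g) by the induction hypothesis. *)
Theorem tau_product (l : seq J) (f : V -> R) (x : V) : uniq l ->
  (forall y, 0 <= f y) -> convex_fct f ->
  prodE p (fun w => expR (infconvs l f (x + \sum_(j <- l) z j (w j) *: b j))) *
  prodE p (fun w => expR (- f (x + \sum_(j <- l) z j (w j) *: b j))) <= 1.
Proof.
move=> ul f0 cf; elim: l ul x => [_ x|j l IH /= /andP[jl ul] x].
  have E g : prodE p (fun w => g (x + \sum_(j <- [::]) z j (w j) *: b j)) = g x.
    rewrite -[RHS](prodE_cst p_sum1); apply: eq_prodE => w.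
    by rewrite big_nil addr0.
  rewrite (E (fun y => expR (f y))) (E (fun y => expR (- f y))).
  by rewrite -expRD subrr expR0.
pose S w := \sum_(i <- l) z i (w i) *: b i.
have S_upd w a : S (upd w j a) = S w.
  apply: eq_big_seq => i il; rewrite ffunE.
  by case: eqP il jl => // -> ->.
have split_j (g : V -> R) : prodE p (fun w =>
      g (x + \sum_(i <- j :: l) z i (w i) *: b i)) =
    \sum_a p j a * prodE p (fun w => g (x + z j a *: b j + S w)).
  rewrite -(prodE_resample p_sum1 (h := fun a w => g (x + z j a *: b j + S w))).
    by apply: eq_prodE => w; rewrite big_cons addrA.
  by move=> a c w; rewrite S_upd.
rewrite (split_j (fun y => expR (infconv k (b j) (infconvs l f) y))).
rewrite (split_j (fun y => expR (- f y))).
(* The partial log-Laplace transform g is again nonnegative and convex, so the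
   one-coordinate inequality applies to it. *)
pose G y := prodE p (fun w => expR (infconvs l f (y + S w))).
pose g y := ln (G y).
have G_gt0 y : 0 < G y by exact: prodE_expR_gt0.
have expg y : expR (g y) = G y by rewrite lnK// posrE.
have g0 y : 0 <= g y.
  rewrite ln_ge0// -(prodE_cst p_sum1 1) le_prodE// => w.
  by rewrite -expR0 ler_expR infconvs_ge0.
have cg : convex_fct g.
  move=> y y' t t01; apply: le_trans (ln_prodE_expR_convex _ _ _ _ t01) => //.
  rewrite ler_ln ?posrE ?prodE_expR_gt0//; apply: le_prodE => // w.
  rewrite ler_expR.
  have -> : t%:C *: y + (1 - t)%:C *: y' + S w =
      t%:C *: (y + S w) + (1 - t)%:C *: (y' + S w).
    by rewrite !scalerDr addrACA -scalerDl -rmorphD subrKC scale1r.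
  exact: infconvs_convex.
apply: le_trans (tau_single (b j) x (p_ge0 j) (p_sum1 j) D_gt0 (z_diam j) g0 cg).
have left_le y : prodE p (fun w => expR (infconv k (b j) (infconvs l f) (y + S w)))
    <= expR (infconv k (b j) g y).
  rewrite -expR_ln_prodE// ler_expR; apply: infconv_ge => s.
  rewrite -ler_expR expR_ln_prodE// expRD expg /G [leRHS]mulrC -prodEZ.
  apply: le_prodE => // w; rewrite -expRD ler_expR.
  apply: le_trans (infconv_le _ _ s k_ge0 (infconvs_ge0 l f0)) _.
  by rewrite addrAC [leRHS]addrC.
have right_le y : prodE p (fun w => expR (- f (y + S w))) <= expR (- g y).
  rewrite expRN expg -[leRHS]mul1r ler_pdivlMr// mulrC; exact: IH.
apply: ler_pM.
- by apply: sumr_ge0 => a _; rewrite mulr_ge0// prodE_ge0// => w; exact: expR_ge0.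
- by apply: sumr_ge0 => a _; rewrite mulr_ge0// prodE_ge0// => w; exact: expR_ge0.
- by apply: ler_sum => a _; rewrite ler_wpM2l.
- by apply: ler_sum => a _; rewrite ler_wpM2l.
Qed.

End TauProduct.

(** * Concentration of convex Lipschitz functions *)

Lemma expR1_le4 (R : realType) : expR 1 <= 4 :> R.
Proof.
have -> : expR 1 = expR (1 / 2) ^+ 2 :> R.
  by rewrite expr2 -expRD; congr expR; field.
have half1 : 1 / 2 < 1 :> R by lra.
have := expR_le_invB half1; have := expR_ge0 (1 / 2 : R).
have -> : (1 - 1 / 2)^-1 = 2 :> R by field.
by nra.
Qed.

(** Lower bound used to read off a variance from exponential moments. *)
Lemma expRDN_ge (R : realType) (x : R) : 2 + x ^+ 2 / 4 <= expR x + expR (- x).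
Proof.
wlog x0 : x / 0 <= x => [h|].
  have [|/ltW x0] := leP 0 x; first exact: h.
  by rewrite -oppr_ge0 in x0; have := h _ x0; rewrite sqrrN opprK; lra.
have h : 1 + x / 2 <= expR (x / 2) by exact: expR_ge1Dx.
have h' : expR (- (x / 2)) <= 1 by rewrite -expR0 ler_expR oppr_le0 divr_ge0.
have -> : expR x = expR (x / 2) ^+ 2 by rewrite expr2 -expRD; congr expR; field.
have -> : expR (- x) = expR (- (x / 2)) ^+ 2.
  by rewrite expr2 -expRD; congr expR; field.
have : expR (x / 2) * expR (- (x / 2)) = 1 by rewrite -expRD subrr expR0.
by nra.
Qed.

Section Concentration.
Variables (R : realType) (V : lmodType R[i]) (J I : finType).
Variables (p : J -> I -> R) (z : J -> I -> R[i]) (b : J -> V) (D : R).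
Hypothesis p_ge0 : forall j a, 0 <= p j a.
Hypothesis p_sum1 : forall j, \sum_a p j a = 1.
Hypothesis D_gt0 : 0 < D.
Hypothesis z_diam : forall j a a', normc (z j a - z j a') <= D.

Variable f : V -> R.
Hypothesis f_ge0 : forall x, 0 <= f x.
Hypothesis f_convex : convex_fct f.
Hypothesis f_lip : forall x (s : J -> R[i]),
  f x <= f (x + \sum_j s j *: b j) + Num.sqrt (\sum_j normc (s j) ^+ 2).

Local Notation k := (16 * D ^+ 2)^-1.
Local Notation E := (prodE p).

(** Iterated infima amount to one infimum over all displacements in the
    coordinates of l. *)
Lemma infconvs_ge (l : seq J) (g : V -> R) x B : uniq l ->
  (forall s : J -> R[i],
    B <= g (x + \sum_(j <- l) s j *: b j) + k * \sum_(j <- l) normc (s j) ^+ 2) ->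
  B <= infconvs b D l g x.
Proof.
elim: l x B => [x B _ /(_ (fun=> 0))|j l IH x B /= /andP[jl ul] hB].
  by rewrite !big_nil mulr0 !addr0.
apply: infconv_ge => s; rewrite -lerBlDr; apply: IH => // u.
pose v i := if i == j then s else u i.
have vl : {in l, v =1 u} by move=> i il; rewrite /v; case: eqP il jl => // -> ->.
have vj : v j = s by rewrite /v eqxx.
have := hB v; rewrite !big_cons vj.
rewrite (eq_big_seq (fun i => u i *: b i)); last by move=> i /vl ->.
rewrite [in X in _ + X](eq_big_seq (fun i => normc (u i) ^+ 2)); last first.
  by move=> i /vl ->.
by rewrite addrA mulrDr; lra.
Qed.

Definition wsum w : V := \sum_j z j (w j) *: b j.

Local Notation F w := (f (wsum w)).

(** For f 1-Lipschitz, the infimum-convolution of r f loses at most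
    sup_N (r N - N^2 / (16 D^2)) = 4 r^2 D^2, where N is the norm of the
    displacement. *)
Lemma laplace_product (r : R) : 0 <= r ->
  E (fun w => expR (r * F w)) * E (fun w => expR (- (r * F w))) <=
  expR (4 * r ^+ 2 * D ^+ 2).
Proof.
move=> r0; pose g x := r * f x.
have g0 x : 0 <= g x by rewrite mulr_ge0.
have cg : convex_fct g.
  move=> x y t t01; have := ler_wpM2l r0 (f_convex x y t01); rewrite /g; lra.
have := tau_product b p_ge0 p_sum1 D_gt0 z_diam 0 (enum_uniq J) g0 cg.
have xE w : 0 + \sum_(j <- enum J) z j (w j) *: b j = wsum w.
  by rewrite add0r big_enum.
under eq_prodE do rewrite xE.
under [X in _ * X]eq_prodE do rewrite xE.
move=> tau; rewrite -[leRHS]mulr1.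
apply: le_trans (ler_wpM2l (expR_ge0 _) tau); rewrite mulrA.
apply: ler_wpM2r; first by apply: prodE_ge0 => // w; exact: expR_ge0.
rewrite -prodEZ; apply: le_prodE => // w; rewrite -expRD ler_expR -lerBlDl.
apply: infconvs_ge; first exact: enum_uniq.
move=> s; rewrite !big_enum /=.
have := ler_wpM2l r0 (f_lip (wsum w) s).
set N2 := \sum_j normc _ ^+ 2.
have N20 : 0 <= N2 by apply: sumr_ge0 => j _; rewrite exprn_ge0 ?normc_ge0.
have := sqr_sqrtr N20; set N := Num.sqrt N2; rewrite /g => NE.
suff : r * N <= k * N2 + 4 * r ^+ 2 * D ^+ 2 by lra.
have D0 : D != 0 by rewrite gt_eqF.
rewrite -subr_ge0 -NE.
have -> : k * N ^+ 2 + 4 * r ^+ 2 * D ^+ 2 - r * N =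
  (N / (4 * D) - 2 * r * D) ^+ 2 by field.
exact: sqr_ge0.
Qed.

Lemma expR_prodE_le g : expR (E g) <= E (fun w => expR (g w)).
Proof.
rewrite -[leLHS]mulr1 -(addr0 1) -(subrr (E g)).
have -> : E g - E g = E (fun w => g w + - E g).
  by rewrite prodED prodE_cst.
rewrite -{1}(prodE_cst p_sum1 1) -prodED -prodEZ; apply: le_prodE => // w.
rewrite -[in leRHS](subrKC (E g) (g w)) expRD ler_wpM2l ?expR_ge0//.
exact: expR_ge1Dx.
Qed.

Let m := E (fun w => F w).

(** Jensen's inequality bounds E exp(- r f) below by exp(- r m), and dividing by
    it in [laplace_product] recentres the other factor. *)
Lemma mgf_upper (r : R) : 0 <= r ->
  E (fun w => expR (r * (F w - m))) <= expR (4 * r ^+ 2 * D ^+ 2).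
Proof.
move=> r0; apply: le_trans (laplace_product r0).
have -> : E (fun w => expR (r * (F w - m))) =
    E (fun w => expR (r * F w)) * expR (- (r * m)).
  rewrite mulrC -prodEZ; apply: eq_prodE => w.
  by rewrite -expRD; congr expR; ring.
rewrite ler_wpM2l//; first by apply: prodE_ge0 => // w; exact: expR_ge0.
have -> : - (r * m) = E (fun w => - (r * F w)).
  by rewrite -mulNr -prodEZ; apply: eq_prodE => w; rewrite mulNr.
exact: expR_prodE_le.
Qed.

Lemma mgf_lower (r : R) : 0 <= r ->
  E (fun w => expR (- (r * (F w - m)))) <= expR (4 * r ^+ 2 * D ^+ 2).
Proof.
move=> r0; apply: le_trans (laplace_product r0).
have -> : E (fun w => expR (- (r * (F w - m)))) =
    expR (r * m) * E (fun w => expR (- (r * F w))).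
  rewrite -prodEZ; apply: eq_prodE => w.
  by rewrite -expRD; congr expR; ring.
rewrite ler_wpM2r//; first by apply: prodE_ge0 => // w; exact: expR_ge0.
by rewrite -prodEZ; exact: expR_prodE_le.
Qed.

(** Chernoff's bound with the optimal parameter r = t / (8 D^2). *)
Lemma tail_mean (t : R) : 0 <= t ->
  E (fun w => (t <= `|F w - m|)%R%:R) <= 2 * expR (- (t ^+ 2 / (16 * D ^+ 2))).
Proof.
move=> t0; have D0 : D != 0 by rewrite gt_eqF.
pose r := t / (8 * D ^+ 2).
have r0 : 0 <= r by rewrite divr_ge0// mulr_ge0 ?exprn_ge0 ?ltW.
apply: (@le_trans _ _ (E (fun w => expR (- (r * t)) *
    (expR (r * (F w - m)) + expR (- (r * (F w - m))))))).
  apply: le_prodE => // w; case: (boolP (t <= _)%R) => [|_]; last first.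
    by rewrite mulr_ge0 ?addr_ge0 ?expR_ge0.
  rewrite ler_normr mulrDr -!expRD => /orP[h|h].
    rewrite -[leLHS]addr0 lerD ?expR_ge0// -expR0 ler_expR.
    by have := ler_wpM2l r0 h; lra.
  rewrite -[leLHS]add0r lerD ?expR_ge0// -expR0 ler_expR.
  by have := ler_wpM2l r0 h; lra.
rewrite prodEZ prodED.
have -> : - (t ^+ 2 / (16 * D ^+ 2)) = - (r * t) + 4 * r ^+ 2 * D ^+ 2.
  by rewrite /r; field.
rewrite expRD mulrCA ler_wpM2l ?expR_ge0//.
by have := mgf_upper r0; have := mgf_lower r0; lra.
Qed.

(** The exponential moments at r = 1 / (2 D) are at most e <= 4. *)
Lemma variance_le : E (fun w => (F w - m) ^+ 2) <= (10 * D) ^+ 2.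
Proof.
have D0 : D != 0 by rewrite gt_eqF.
pose r := (2 * D)^-1.
have r0 : 0 <= r by rewrite invr_ge0 mulr_ge0 ?ltW.
have h : E (fun w => 2 + (r ^+ 2 / 4) * (F w - m) ^+ 2) <=
    E (fun w => expR (r * (F w - m)) + expR (- (r * (F w - m)))).
  apply: le_prodE => // w; rewrite mulrAC -exprMn; exact: expRDN_ge.
move: h; rewrite !prodED prodEZ prodE_cst//.
have := mgf_upper r0; have := mgf_lower r0.
have -> : 4 * r ^+ 2 * D ^+ 2 = 1 by rewrite /r; field.
have e4 := expR1_le4 R.
set v := E (fun w => (F w - m) ^+ 2) => h1 h2 h3.
have : r ^+ 2 / 4 * v <= 6 by lra.
have -> : r ^+ 2 / 4 = (16 * D ^+ 2)^-1 by rewrite /r; field.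
rewrite mulrC ler_pdivrMr ?mulr_gt0 ?exprn_gt0//.
by have := sqr_ge0 D; nra.
Qed.

(** The square of the quadratic mean is m^2 plus the variance. *)
Lemma sqrt_prodE_sqr : `|Num.sqrt (E (fun w => F w ^+ 2)) - m| <= 10 * D.
Proof.
have m0 : 0 <= m by apply: prodE_ge0.
have := variance_le; set v := E _ => hv.
have v0 : 0 <= v by apply: prodE_ge0 => // w; exact: sqr_ge0.
have -> : E (fun w => F w ^+ 2) = m ^+ 2 + v.
  have -> : v = E (fun w => F w ^+ 2 + (- 2 * m * F w + m ^+ 2)).
    by apply: eq_prodE => w; ring.
  by rewrite prodED prodED prodEZ prodE_cst// -/m; ring.
have h : m <= Num.sqrt (m ^+ 2 + v).
  by rewrite -[leLHS](ger0_norm m0) -sqrtr_sqr ler_wsqrtr// lerDl.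
rewrite ger0_norm ?subr_ge0// lerBlDl.
have h2 : 0 <= m + 10 * D by rewrite addr_ge0// mulr_ge0// ltW.
rewrite -[leRHS](ger0_norm h2) -sqrtr_sqr ler_wsqrtr//.
by have := mulr_ge0 m0 (ltW D_gt0); nra.
Qed.

Theorem concentration_L2 (t : R) : 0 <= t ->
  E (fun w => (t + 10 * D <= `|F w - Num.sqrt (E (fun w => F w ^+ 2))|)%R%:R) <=
  2 * expR (- (t ^+ 2 / (16 * D ^+ 2))).
Proof.
move=> t0; apply: le_trans (tail_mean t0); apply: le_prodE => // w.
have := sqrt_prodE_sqr; set q := Num.sqrt _ => hq.
case: (boolP (t + _ <= _)%R) => // h.
have : `|F w - q| <= `|F w - m| + `|q - m|.
  by rewrite [`|q - m|]distrC ler_distD.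
by case: (boolP (t <= _)%R) => // /negP h1 h2; exfalso; apply: h1; lra.
Qed.

End Concentration.

(** * The weighted projection seminorm *)

Section EuclideanNorm.
Variables (R : realType) (J : finType).
Implicit Types a b : J -> R.

(** With A = sum a^2, B = sum b^2, C = sum a b, the sum of the squares of
    A b - C a equals A (A B - C^2), which is therefore nonnegative. *)
Lemma cauchy_schwarz_sum a b :
  (\sum_j a j * b j) ^+ 2 <= (\sum_j a j ^+ 2) * (\sum_j b j ^+ 2).
Proof.
set A := \sum_j a j ^+ 2; set B := \sum_j b j ^+ 2; set C := \sum_j _.
have A0 : 0 <= A by apply: sumr_ge0 => j _; exact: sqr_ge0.
have [A00|An0] := eqVneq A 0.
  have a0 j : a j = 0.
    have /psumr_eq0P h := A00.
    by apply/eqP; rewrite -sqrf_eq0 h// => i _; exact: sqr_ge0.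
  by rewrite A00 mul0r /C big1 ?expr0n// => j _; rewrite a0 mul0r.
have Agt0 : 0 < A by rewrite lt_neqAle eq_sym An0.
have : 0 <= \sum_j (A * b j - C * a j) ^+ 2.
  by apply: sumr_ge0 => j _; exact: sqr_ge0.
have -> : \sum_j (A * b j - C * a j) ^+ 2 = A * (A * B - C ^+ 2).
  transitivity (\sum_j (A ^+ 2 * b j ^+ 2 + (- (2 * A * C) * (a j * b j) +
                        C ^+ 2 * a j ^+ 2))).
    by apply: eq_bigr => j _; ring.
  by rewrite !big_split -!mulr_sumr -/A -/B -/C /=; ring.
by rewrite pmulr_rge0// subr_ge0.
Qed.

Lemma minkowski_sum a b :
  Num.sqrt (\sum_j (a j + b j) ^+ 2) <=
  Num.sqrt (\sum_j a j ^+ 2) + Num.sqrt (\sum_j b j ^+ 2).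
Proof.
have A0 : 0 <= \sum_j a j ^+ 2 by apply: sumr_ge0 => j _; exact: sqr_ge0.
have B0 : 0 <= \sum_j b j ^+ 2 by apply: sumr_ge0 => j _; exact: sqr_ge0.
set s := _ + _; have s0 : 0 <= s by rewrite addr_ge0 ?sqrtr_ge0.
rewrite -[leRHS](ger0_norm s0) -sqrtr_sqr ler_wsqrtr// sqrrD !sqr_sqrtr//.
have -> : \sum_j (a j + b j) ^+ 2 =
    \sum_j a j ^+ 2 + 2 * (\sum_j a j * b j) + \sum_j b j ^+ 2.
  by rewrite mulr_sumr -!big_split; apply: eq_bigr => j _ /=; ring.
have : \sum_j a j * b j <=
    Num.sqrt (\sum_j a j ^+ 2) * Num.sqrt (\sum_j b j ^+ 2).
  apply: le_trans (ler_norm _) _; rewrite -sqrtr_sqr -sqrtrM//.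
  by rewrite ler_wsqrtr// cauchy_schwarz_sum.
by rewrite -mulr_natl; lra.
Qed.

End EuclideanNorm.

Section HermitianProduct.
Variables (R : realType) (n : nat).
Implicit Types (u v x y : 'cV[R[i]]_n).

Lemma sqr_normcE (s : R[i]) :
  normc s ^+ 2 = complex.Re s ^+ 2 + complex.Im s ^+ 2.
Proof. by case: s => a b; rewrite /= sqr_sqrtr// addr_ge0 ?sqr_ge0. Qed.

Lemma mul_conj_normc (s : R[i]) : s^* * s = (normc s ^+ 2)%:C.
Proof.
rewrite sqr_normcE; case: s => a b; apply/eqP; rewrite eq_complex /=.
by apply/andP; split; apply/eqP; ring.
Qed.

Lemma conj_realc (r : R) : (r%:C)^* = r%:C.
Proof. exact: conjc_real. Qed.

Lemma hdotE u v : hdot u v = \sum_i (u i 0)^* * v i 0.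
Proof. by rewrite /hdot mxE; apply: eq_bigr => i _; rewrite !mxE. Qed.

Lemma hdotDr u x y : hdot u (x + y) = hdot u x + hdot u y.
Proof. by rewrite /hdot mulmxDr mxE. Qed.

Lemma hdotZr u s x : hdot u (s *: x) = s * hdot u x.
Proof. by rewrite /hdot -scalemxAr mxE. Qed.

Lemma hdot_sumr (J : finType) u (x : J -> 'cV[R[i]]_n) :
  hdot u (\sum_j x j) = \sum_j hdot u (x j).
Proof. by rewrite /hdot mulmx_sumr summxE. Qed.

Lemma hdotC u v : hdot v u = (hdot u v)^*.
Proof.
rewrite !hdotE rmorph_sum; apply: eq_bigr => i _.
by rewrite rmorphM /= conjCK mulrC.
Qed.

Lemma hdot_diag x : hdot x x = (\sum_i normc (x i 0) ^+ 2)%:C.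
Proof. by rewrite hdotE rmorph_sum; apply: eq_bigr => i _; exact: mul_conj_normc. Qed.

Lemma hdot_delta u i : hdot u (delta_mx i 0) = (u i 0)^*.
Proof.
rewrite hdotE (bigD1 i)//= mxE !eqxx mulr1 big1 ?addr0// => j /negbTE ij.
by rewrite mxE ij mulr0.
Qed.

(** The residual y of x after projection is orthogonal to every u_j, so
    <y, y> = <y, x> = |x|^2 - sum_j |<u_j, x>|^2. *)
Lemma bessel_le d (u : d.-tuple 'cV[R[i]]_n) x :
  (forall j k : 'I_d, hdot (tnth u j) (tnth u k) = (j == k)%:R) ->
  \sum_(j < d) normc (hdot (tnth u j) x) ^+ 2 <= \sum_i normc (x i 0) ^+ 2.
Proof.
move=> ou; pose h j := hdot (tnth u j) x.
pose y := x + \sum_j (- h j) *: tnth u j.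
have uy j : hdot (tnth u j) y = 0.
  rewrite hdotDr hdot_sumr (bigD1 j)//= hdotZr ou eqxx mulr1 big1 ?addr0 ?subrr//.
  by move=> k /negbTE kj; rewrite hdotZr ou eq_sym kj mulr0.
have xy : hdot y x = hdot y y.
  have -> : hdot y y = hdot y x + \sum_j hdot y (- h j *: tnth u j).
    by rewrite -hdot_sumr -hdotDr.
  by rewrite big1 ?addr0// => j _; rewrite hdotZr hdotC uy conjC0 mulr0.
have : hdot y x = (\sum_i normc (x i 0) ^+ 2 - \sum_j normc (h j) ^+ 2)%:C.
  have -> : hdot y x = (hdot x x + \sum_j hdot x (- h j *: tnth u j))^*.
    by rewrite -hdot_sumr -hdotDr -hdotC.
  rewrite hdot_diag rmorphD rmorphB /= conj_realc; congr (_ + _).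
  rewrite !rmorph_sum -sumrN; apply: eq_bigr => j _ /=.
  by rewrite hdotZr hdotC -mul_conj_normc rmorphM rmorphN /= conjCK mulNr.
rewrite xy hdot_diag => /complexI h'.
by rewrite -subr_ge0 -h' sumr_ge0// => i _; rewrite exprn_ge0 ?normc_ge0.
Qed.

Variables (d : nat) (u : d.-tuple 'cV[R[i]]_n) (c : 'I_d -> R).
Hypothesis u_on : forall j k : 'I_d, hdot (tnth u j) (tnth u k) = (j == k)%:R.
Hypothesis c01 : forall j, 0 <= c j <= 1.

Definition wnorm x : R :=
  Num.sqrt (\sum_(j < d) c j * normc (hdot (tnth u j) x) ^+ 2).

Let c0 j : 0 <= c j. Proof. by have /andP[] := c01 j. Qed.

Lemma wnorm_ge0 x : 0 <= wnorm x. Proof. exact: sqrtr_ge0. Qed.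

Lemma sqr_wnorm x :
  wnorm x ^+ 2 = \sum_(j < d) c j * normc (hdot (tnth u j) x) ^+ 2.
Proof. by rewrite sqr_sqrtr// sumr_ge0// => j _; rewrite cost_ge0. Qed.

Lemma wnormE x :
  wnorm x = Num.sqrt (\sum_j (Num.sqrt (c j) * normc (hdot (tnth u j) x)) ^+ 2).
Proof.
by congr Num.sqrt; apply: eq_bigr => j _; rewrite exprMn sqr_sqrtr.
Qed.

Lemma wnormD_le x y : wnorm (x + y) <= wnorm x + wnorm y.
Proof.
rewrite (wnormE x) (wnormE y); apply: le_trans (minkowski_sum _ _).
rewrite wnormE ler_wsqrtr//; apply: ler_sum => j _.
rewrite -mulrDr hdotDr; apply: lerXn2r;
  rewrite ?nnegrE ?mulr_ge0 ?addr_ge0 ?sqrtr_ge0 ?normc_ge0//.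
by rewrite ler_wpM2l ?sqrtr_ge0// normcD_le.
Qed.

Lemma wnormZ (s : R[i]) x : wnorm (s *: x) = normc s * wnorm x.
Proof.
rewrite /wnorm -[in RHS](ger0_norm (normc_ge0 s)) -sqrtr_sqr -sqrtrM ?sqr_ge0//.
rewrite mulr_sumr; congr Num.sqrt; apply: eq_bigr => j _.
by rewrite hdotZr ComplexField.Normc.normcM; ring.
Qed.

Lemma wnorm_convex : convex_fct wnorm.
Proof.
move=> x y t /andP[t0 t1]; apply: le_trans (wnormD_le _ _) _.
by rewrite !wnormZ !normc_real !ger0_norm ?subr_ge0.
Qed.

Lemma wnorm_le x : wnorm x <= Num.sqrt (\sum_i normc (x i 0) ^+ 2).
Proof.
rewrite ler_wsqrtr//; apply: le_trans (bessel_le x u_on); apply: ler_sum => j _.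
by rewrite ler_piMl ?exprn_ge0 ?normc_ge0//; have /andP[] := c01 j.
Qed.

Lemma wnorm_lip x y :
  wnorm x <= wnorm y + Num.sqrt (\sum_i normc (x i 0 - y i 0) ^+ 2).
Proof.
have := wnormD_le y (x - y); rewrite subrKC => /le_trans; apply.
rewrite lerD2l; apply: le_trans (wnorm_le _) _.
by rewrite ler_wsqrtr//; apply: ler_sum => i _; rewrite !mxE.
Qed.

Lemma sum_normc_basis j : \sum_i normc (hdot (tnth u j) (delta_mx i 0)) ^+ 2 = 1.
Proof.
have := u_on j j; rewrite hdot_diag eqxx => /complexI <-.
apply: eq_bigr => i _; rewrite hdot_delta.
by case: (tnth u j i 0) => a b /=; rewrite sqrrN.
Qed.

(** Each u_j has norm 1, so sum_j c_j is at most the sum over i of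
    sum_j |<u_j, delta_i>|^2, and Bessel's inequality bounds each of these by
    1. *)
Lemma sum_weights_le : \sum_j c j <= n%:R.
Proof.
have -> : \sum_j c j =
    \sum_j \sum_i c j * normc (hdot (tnth u j) (delta_mx i 0)) ^+ 2.
  by apply: eq_bigr => j _; rewrite -mulr_sumr sum_normc_basis mulr1.
rewrite exchange_big /= -[n in n%:R]card_ord -sumr_const; apply: ler_sum => i _.
apply: (@le_trans _ _ (\sum_j normc (hdot (tnth u j) (delta_mx i 0)) ^+ 2)).
  apply: ler_sum => j _; rewrite ler_piMl ?exprn_ge0 ?normc_ge0//.
  by have /andP[] := c01 j.
apply: le_trans (bessel_le _ u_on) _; rewrite (bigD1 i)//= mxE !eqxx.
rewrite ComplexField.Normc.normc1 expr1n big1 ?addr0// => k /negbTE ki.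
by rewrite mxE ki ComplexField.Normc.normc0 expr0n.
Qed.

End HermitianProduct.

(** * Second moments *)

Section SecondMoment.
Variables (R : realType) (J I : finType) (p : J -> I -> R).
Hypothesis p_ge0 : forall j a, 0 <= p j a.
Hypothesis p_sum1 : forall j, \sum_a p j a = 1.
Local Notation E := (prodE p).

Lemma prodE_coord j (g : I -> R) : E (fun w => g (w j)) = \sum_a p j a * g a.
Proof.
rewrite (prodE_resample p_sum1 (h := fun a _ => g a))//.
by apply: eq_bigr => a _; rewrite prodE_cst.
Qed.

Lemma prodE_sqr_sum (x : J -> I -> R) (c : R) :
  (forall j, \sum_a p j a * x j a = 0) ->
  E (fun w => (c + \sum_j x j (w j)) ^+ 2) =
  c ^+ 2 + \sum_j \sum_a p j a * x j a ^+ 2.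
Proof.
move=> x0.
have -> : E (fun w => (c + \sum_j x j (w j)) ^+ 2) =
    E (fun w => c ^+ 2 + (2 * c * (\sum_j x j (w j)) +
                \sum_i \sum_j x i (w i) * x j (w j))).
  apply: eq_prodE => w.
  have -> : \sum_i \sum_j x i (w i) * x j (w j) = (\sum_j x j (w j)) ^+ 2.
    by rewrite expr2 mulr_suml; apply: eq_bigr => i _; rewrite mulr_sumr.
  by ring.
rewrite !prodED prodE_cst// prodEZ prodE_sum big1 ?mulr0 ?add0r; last first.
  by move=> j _; rewrite prodE_coord x0.
congr (_ + _); rewrite prodE_sum; apply: eq_bigr => i _.
rewrite prodE_sum (bigD1 i)//= big1 ?addr0.
  exact: (prodE_coord i (fun a => x i a * x i a)).
move=> j /negbTE ji.
rewrite (prodE_resample p_sum1 (h := fun a w => x i a * x j (w j))); last first.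
  by move=> a a' w; rewrite ffunE ji.
under eq_bigr do rewrite prodEZ mulrA.
by rewrite -mulr_suml x0 mul0r.
Qed.

Variable z : J -> I -> R[i].

Definition dmean j : R[i] :=
  (\sum_a p j a * complex.Re (z j a)) +i* (\sum_a p j a * complex.Im (z j a)).

Definition dvar j : R := \sum_a p j a * normc (z j a - dmean j) ^+ 2.

Lemma Re_dmean_centered j : \sum_a p j a * complex.Re (z j a - dmean j) = 0.
Proof.
transitivity (\sum_a (p j a * complex.Re (z j a) - p j a * complex.Re (dmean j))).
  by apply: eq_bigr => a _; rewrite -mulrBr raddfB.
by rewrite sumrB -mulr_suml p_sum1 mul1r subrr.
Qed.

Lemma Im_dmean_centered j : \sum_a p j a * complex.Im (z j a - dmean j) = 0.
Proof.
transitivity (\sum_a (p j a * complex.Im (z j a) - p j a * complex.Im (dmean j))).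
  by apply: eq_bigr => a _; rewrite -mulrBr raddfB.
by rewrite sumrB -mulr_suml p_sum1 mul1r subrr.
Qed.

Lemma ReM (s s' : R[i]) : complex.Re (s * s') =
  complex.Re s * complex.Re s' - complex.Im s * complex.Im s'.
Proof. by case: s s' => a b [a' b']. Qed.

Lemma ImM (s s' : R[i]) : complex.Im (s * s') =
  complex.Re s * complex.Im s' + complex.Im s * complex.Re s'.
Proof. by case: s s' => a b [a' b'] /=; rewrite addrC. Qed.

(** Real and imaginary parts are centred sums of independent terms, up to the
    constant m, so their cross terms vanish. *)
Lemma prodE_sqr_linear (v : J -> R[i]) :
  E (fun w => normc (\sum_j z j (w j) * v j) ^+ 2) =
  normc (\sum_j dmean j * v j) ^+ 2 + \sum_j normc (v j) ^+ 2 * dvar j.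
Proof.
set m := \sum_j dmean j * v j.
pose y j a := (z j a - dmean j) * v j.
have sumE w : \sum_j z j (w j) * v j = m + \sum_j y j (w j).
  by rewrite -big_split; apply: eq_bigr => j _; rewrite /= /y; ring.
have -> : E (fun w => normc (\sum_j z j (w j) * v j) ^+ 2) =
   E (fun w => (complex.Re m + \sum_j complex.Re (y j (w j))) ^+ 2 +
               (complex.Im m + \sum_j complex.Im (y j (w j))) ^+ 2).
  apply: eq_prodE => w.
  by rewrite sumE sqr_normcE !raddfD !raddf_sum.
rewrite prodED (prodE_sqr_sum (x := fun j a => complex.Re (y j a))); last first.
  move=> j; transitivity (complex.Re (v j) * (\sum_a p j a * complex.Re (z j a - dmean j))
    - complex.Im (v j) * (\sum_a p j a * complex.Im (z j a - dmean j))).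
    by rewrite !mulr_sumr -sumrB; apply: eq_bigr => a _; rewrite ReM; ring.
  by rewrite Re_dmean_centered Im_dmean_centered !mulr0 subrr.
rewrite (prodE_sqr_sum (x := fun j a => complex.Im (y j a))); last first.
  move=> j; transitivity (complex.Im (v j) * (\sum_a p j a * complex.Re (z j a - dmean j))
    + complex.Re (v j) * (\sum_a p j a * complex.Im (z j a - dmean j))).
    by rewrite !mulr_sumr -big_split; apply: eq_bigr => a _ /=; rewrite ImM; ring.
  by rewrite Re_dmean_centered Im_dmean_centered !mulr0 addr0.
rewrite addrACA -sqr_normcE; congr (_ + _); rewrite -big_split.
apply: eq_bigr => j _; rewrite /dvar mulr_sumr -big_split; apply: eq_bigr => a _ /=.
rewrite -mulrDr -sqr_normcE /y ComplexField.Normc.normcM; ring.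
Qed.

End SecondMoment.

Section WeightedProjection.
Variables (R : realType) (n d : nat) (I : finType).
Variables (p : 'I_n -> I -> R) (z : 'I_n -> I -> R[i]).
Hypothesis p_ge0 : forall j a, 0 <= p j a.
Hypothesis p_sum1 : forall j, \sum_a p j a = 1.
Variables (u : d.-tuple 'cV[R[i]]_n) (c : 'I_d -> R).
Hypothesis u_on : forall j k : 'I_d, hdot (tnth u j) (tnth u k) = (j == k)%:R.
Hypothesis c01 : forall j, 0 <= c j <= 1.
Local Notation E := (prodE p).

Definition dvec (w : {ffun 'I_n -> I}) : 'cV[R[i]]_n := \col_i z i (w i).

Lemma col_sum_delta (x : 'I_n -> R[i]) :
  \col_i x i = \sum_i x i *: delta_mx i 0 :> 'cV[R[i]]_n.
Proof.
apply/colP => i; rewrite mxE summxE (bigD1 i)//= big1 ?addr0.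
  by rewrite !mxE !eqxx mulr1.
by move=> j /negbTE ji; rewrite !mxE eq_sym ji mulr0.
Qed.

Lemma hdot_col v (x : 'I_n -> R[i]) :
  hdot v (\col_i x i) = \sum_i x i * hdot v (delta_mx i 0).
Proof.
by rewrite col_sum_delta hdot_sumr; apply: eq_bigr => i _; rewrite hdotZr.
Qed.

Lemma prodE_sqr_wnorm : E (fun w => wnorm u c (dvec w) ^+ 2) =
  wnorm u c (\col_i dmean p z i) ^+ 2 +
  \sum_j c j * \sum_i normc (hdot (tnth u j) (delta_mx i 0)) ^+ 2 * dvar p z i.
Proof.
have -> : E (fun w => wnorm u c (dvec w) ^+ 2) =
    E (fun w => \sum_j c j *
      normc (\sum_i z i (w i) * hdot (tnth u j) (delta_mx i 0)) ^+ 2).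
  apply: eq_prodE => w; rewrite sqr_wnorm//.
  by apply: eq_bigr => j _; rewrite hdot_col.
rewrite prodE_sum sqr_wnorm// -big_split; apply: eq_bigr => j _ /=.
by rewrite prodEZ prodE_sqr_linear// mulrDr hdot_col.
Qed.

(** The squared quadratic mean is B + A with B <= n e2^2, by domination of f by
    the Euclidean norm, and |A - S| <= S e3 for S = sum_j c_j, by
    normalisation of the u_j. Hence the quadratic mean lies between
    sqrt(S) (1 - e3) and sqrt(S) (1 + e3) + sqrt(n) e2, and S <= n. *)
Lemma sqrt_prodE_sqr_wnorm (e2 e3 : R) :
  (forall i, normc (dmean p z i) <= e2) ->
  (forall i, `|dvar p z i - 1| <= e3) -> 0 <= e2 -> 0 <= e3 ->
  `|Num.sqrt (E (fun w => wnorm u c (dvec w) ^+ 2)) - Num.sqrt (\sum_j c j)|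
    <= n%:R * (e2 + e3).
Proof.
move=> he2 he3 e20 e30.
have c0 j : 0 <= c j by have /andP[] := c01 j.
set S := \sum_j c j.
have S0 : 0 <= S by exact: sumr_ge0.
rewrite prodE_sqr_wnorm; set B := wnorm _ _ _ ^+ 2; set A := \sum_j _.
have B0 : 0 <= B by exact: sqr_ge0.
have BE : B <= n%:R * e2 ^+ 2.
  apply: (@le_trans _ _ (Num.sqrt (\sum_i normc ((\col_i dmean p z i) i 0) ^+ 2) ^+ 2)).
    by apply: lerXn2r; rewrite ?nnegrE ?wnorm_ge0 ?sqrtr_ge0 ?wnorm_le.
  rewrite sqr_sqrtr; last by apply: sumr_ge0 => i _; rewrite exprn_ge0 ?normc_ge0.
  rewrite -[n in n%:R]card_ord mulr_natl -sumr_const; apply: ler_sum => i _.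
  by rewrite mxE; apply: lerXn2r; rewrite ?nnegrE ?normc_ge0.
have AS : `|A - S| <= S * e3.
  have -> : A - S = \sum_j c j *
      \sum_i normc (hdot (tnth u j) (delta_mx i 0)) ^+ 2 * (dvar p z i - 1).
    rewrite -sumrB; apply: eq_bigr => j _.
    rewrite -[X in _ - X]mulr1 -[X in _ - _ * X](sum_normc_basis u_on j) -mulrBr -sumrB.
    by congr (_ * _); apply: eq_bigr => i _; rewrite mulrBr mulr1.
  rewrite mulr_suml; apply: le_trans (ler_norm_sum _ _ _) _; apply: ler_sum => j _.
  rewrite normrM ger0_norm// ler_wpM2l//; apply: le_trans (ler_norm_sum _ _ _) _.
  rewrite -[leRHS]mul1r -[X in _ <= X * _](sum_normc_basis u_on j) mulr_suml.
  apply: ler_sum => i _; rewrite normrM ger0_norm ?exprn_ge0 ?normc_ge0//.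
  by rewrite ler_wpM2l ?exprn_ge0 ?normc_ge0.
have A0 : 0 <= A.
  apply: sumr_ge0 => j _; rewrite mulr_ge0// sumr_ge0// => i _.
  rewrite mulr_ge0 ?exprn_ge0 ?normc_ge0// sumr_ge0// => a _.
  by rewrite mulr_ge0 ?exprn_ge0 ?normc_ge0.
have N0 : 0 <= n%:R :> R by [].
have Sn : Num.sqrt S <= Num.sqrt n%:R by rewrite ler_wsqrtr// (sum_weights_le u_on).
have NN : Num.sqrt n%:R <= n%:R :> R.
  case: (n) => [|k]; first by rewrite sqrtr0.
  rewrite -[leRHS](ger0_norm (ler0n R k.+1)) -sqrtr_sqr ler_wsqrtr//.
  by rewrite expr2 ler_peMr// ler1n.
have s0 := sqrtr_ge0 S; have r0 := sqrtr_ge0 (n%:R : R).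
have sS := sqr_sqrtr S0; have rN := sqr_sqrtr N0.
have q0 := sqrtr_ge0 (B + A); have qBA := sqr_sqrtr (addr_ge0 B0 A0).
move: s0 r0 sS rN q0 qBA Sn NN.
set s := Num.sqrt S; set r := Num.sqrt n%:R; set q := Num.sqrt (B + A).
move=> s0 r0 sS rN q0 qBA Sn NN.
move: AS; rewrite !ler_norml => /andP[AS1 AS2].
have re2 : 0 <= r * e2 by rewrite mulr_ge0.
have nr : 0 <= (n%:R - r) * (e2 + e3) by rewrite mulr_ge0 ?subr_ge0 ?addr_ge0.
have rs : 0 <= (r - s) * e3 by rewrite mulr_ge0 ?subr_ge0.
have se3 : 0 <= s * (1 + e3) by rewrite mulr_ge0 ?addr_ge0.
have Se3 : 0 <= S * e3 by rewrite mulr_ge0.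
apply/andP; split.
- have [e31|/ltW e31] := leP 1 e3.
    have : 0 <= s * (e3 - 1) by rewrite mulr_ge0 ?subr_ge0.
    by lra.
  suff : s * (1 - e3) <= q by lra.
  have t0 : 0 <= s * (1 - e3) by rewrite mulr_ge0 ?subr_ge0.
  rewrite -ler_sqr ?nnegrE//.
  have : 0 <= S * e3 * (1 - e3) by rewrite mulr_ge0 ?subr_ge0.
  by rewrite exprMn sS; nra.
- suff : q <= s * (1 + e3) + r * e2 by lra.
  have t0 : 0 <= s * (1 + e3) + r * e2 by rewrite addr_ge0.
  rewrite -ler_sqr ?nnegrE// qBA.
  have : 0 <= s * (1 + e3) * (r * e2) by rewrite mulr_ge0.
  have : 0 <= S * e3 * (1 + e3) by rewrite mulr_ge0 ?addr_ge0.
  have -> : (s * (1 + e3) + r * e2) ^+ 2 = s ^+ 2 * (1 + e3) ^+ 2 +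
    2 * (s * (1 + e3) * (r * e2)) + r ^+ 2 * e2 ^+ 2 by ring.
  by rewrite sS rN; nra.
Qed.

End WeightedProjection.

(** * Tail bound for finitely valued vectors *)

Section DiscreteTail.
Variables (R : realType) (n d : nat) (I : finType).
Variables (p : 'I_n -> I -> R) (z : 'I_n -> I -> R[i]) (D : R).
Hypothesis p_ge0 : forall j a, 0 <= p j a.
Hypothesis p_sum1 : forall j, \sum_a p j a = 1.
Hypothesis D_gt0 : 0 < D.
Hypothesis z_diam : forall j a a', normc (z j a - z j a') <= D.
Variables (u : d.-tuple 'cV[R[i]]_n) (c : 'I_d -> R).
Hypothesis u_on : forall j k : 'I_d, hdot (tnth u j) (tnth u k) = (j == k)%:R.
Hypothesis c01 : forall j, 0 <= c j <= 1.

Theorem discrete_tail (e2 e3 t : R) :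
  (forall i, normc (dmean p z i) <= e2) ->
  (forall i, `|dvar p z i - 1| <= e3) -> 0 <= e2 -> 0 <= e3 -> 0 <= t ->
  prodE p (fun w => (t + 10 * D + n%:R * (e2 + e3) <=
    `|wnorm u c (dvec z w) - Num.sqrt (\sum_j c j)|)%R%:R) <=
  2 * expR (- (t ^+ 2 / (16 * D ^+ 2))).
Proof.
move=> he2 he3 e20 e30 t0.
pose b i : 'cV[R[i]]_n := delta_mx i 0.
have lip x (s : 'I_n -> R[i]) : wnorm u c x <=
    wnorm u c (x + \sum_j s j *: b j) + Num.sqrt (\sum_j normc (s j) ^+ 2).
  rewrite -col_sum_delta; apply: le_trans (wnorm_lip u_on c01 x (x + \col_i s i)) _.
  rewrite lerD2l ler_wsqrtr//; apply: ler_sum => i _; rewrite !mxE opprD addNKr.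
  by case: (s i) => a b' /=; rewrite !sqrrN.
have := concentration_L2 p_ge0 p_sum1 D_gt0 z_diam (wnorm_ge0 u c)
  (wnorm_convex u c01) lip t0.
apply: le_trans; apply: le_prodE => // w.
have dE (v : {ffun 'I_n -> I}) : wsum z b v = dvec z v by rewrite /dvec col_sum_delta.
have -> : prodE p (fun w => wnorm u c (wsum z b w) ^+ 2) =
    prodE p (fun w => wnorm u c (dvec z w) ^+ 2).
  by apply: eq_prodE => v; rewrite dE.
rewrite dE; have := sqrt_prodE_sqr_wnorm p_ge0 p_sum1 u_on c01 he2 he3 e20 e30.
set q := Num.sqrt (prodE _ _); set s := Num.sqrt _; set f := wnorm _ _ _ => hq.
case: (boolP (t + _ + _ <= _)%R) => // h.
have := ler_distD q f s.
by case: (boolP (t + _ <= _)%R) => // /negP h1 h2; exfalso; apply: h1; lra.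
Qed.

End DiscreteTail.

(** * Expectations through finite partitions *)

Section ExpectationPartition.
Context (disp : measure_display) (T : measurableType disp) (R : realType).
Variable P : probability T R.
Variables (I : finType) (A : I -> set T).
Hypothesis mA : forall a, measurable (A a).
Hypothesis A_cover : forall w, exists a, A a w.
Hypothesis A_disj : forall a a' w, A a w -> A a' w -> a = a'.

Lemma fine_probability_setT : fine (P setT) = 1.
Proof. exact: (congr1 fine (probability_setT P)). Qed.

Lemma simple_partitionE (g : I -> R) a w : A a w ->
  \sum_a' g a' * \1_(A a') w = g a.
Proof.
move=> Aw; rewrite (bigD1 a)//= indicE mem_set// mulr1 big1 ?addr0// => a' aa'.
rewrite indicE memNset ?mulr0// => Aw'.
by rewrite (A_disj Aw Aw') eqxx in aa'.
Qed.

Lemma Rintegral_simple (g : I -> R) :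
  \int[P]_w (\sum_a g a * \1_(A a) w) = \sum_a fine (P (A a)) * g a.
Proof.
have int1 a : P.-integrable setT (fun w => (\1_(A a) w)%:E).
  exact: integrable_indic.
rewrite /Rintegral.
under eq_integral do rewrite -sumEFin.
rewrite integral_sum//; last first.
  move=> a; under eq_fun do rewrite EFinM.
  exact: integrableZl.
rewrite (eq_bigr (fun a => (fine (P (A a)) * g a)%:E)) ?sumEFin// => a _.
under eq_integral do rewrite EFinM.
rewrite integralZl// integral_indic// setIT EFinM fineK ?fin_num_measure//.
by rewrite muleC.
Qed.

Lemma partition_sum1 : \sum_a fine (P (A a)) = 1.
Proof.
have := Rintegral_simple (fun=> 1).
under [RHS]eq_bigr do rewrite mulr1.
move=> <-; rewrite (@eq_Rintegral _ _ _ _ _ (fun=> 1)).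
  by rewrite Rintegral_cst// fine_probability_setT mul1r.
by move=> w _; have [a aw] := A_cover w; rewrite (simple_partitionE _ aw).
Qed.

(** The integral of h is compared with that of the function equal to g a on the
    cell A a. *)
Lemma expectation_partition (h : T -> R) (g : I -> R) (eta : R) :
  measurable_fun setT h -> (forall a w, A a w -> `|h w - g a| <= eta) ->
  `|fine 'E_P[h] - \sum_a fine (P (A a)) * g a| <= eta.
Proof.
move=> mh hg; pose s w := \sum_a g a * \1_(A a) w.
have ms : measurable_fun setT s.
  apply: measurable_sum => a; apply: measurable_funM => //.
have bs w : `|s w| <= \sum_a `|g a|.
  have [a aw] := A_cover w; rewrite /s (simple_partitionE _ aw).
  by rewrite (bigD1 a)//= lerDl sumr_ge0.
have hs w : `|h w - s w| <= eta.
  by have [a aw] := A_cover w; rewrite /s (simple_partitionE _ aw) hg.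
have bnd (f : T -> R) M : measurable_fun setT f -> (forall w, `|f w| <= M) ->
    P.-integrable setT (EFin \o f).
  move=> mf fM; apply: measurable_bounded_integrable => //.
    by rewrite (le_lt_trans (probability_le1 _ _)) ?ltry.
  exists M; split; first exact: num_real.
  by move=> x Mx w _; exact: le_trans (fM w) (ltW Mx).
have is_ : P.-integrable setT (EFin \o s) by exact: bnd bs.
have ih : P.-integrable setT (EFin \o h).
  apply: (bnd _ (eta + \sum_a `|g a|)) => // w.
  rewrite -[h w](subrK (s w)); apply: le_trans (ler_normD _ _) _.
  exact: lerD.
rewrite -Rintegral_simple unlock -[fine _]/(\int[P]_w h w) -RintegralB//.
apply: le_trans (le_normr_Rintegral _ _) _ => //.
  by apply: (bnd _ eta) => //; exact: measurable_funB.
have -> : eta = \int[P]_(x in setT) eta.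
  by rewrite Rintegral_cst// fine_probability_setT mulr1.
apply: le_Rintegral => //.
  apply: (bnd _ eta) => [|w]; last by rewrite normr_id.
  by apply: measurableT_comp => //; exact: measurable_funB.
by apply: (bnd _ `|eta|) => // w.
Qed.

End ExpectationPartition.

(** * Measurability of complex-valued functions *)

Section ComplexMeasurability.
Context (disp : measure_display) (T : measurableType disp) (R : realType).
Implicit Types X Y : T -> R[i].

Lemma measurable_Re : measurable_fun setT (@complex.Re R : R[i] -> R).
Proof.
move=> _ B mB; rewrite setTI.
exists (B `*` setT); first exact: measurableX.
by rewrite setTI; apply/seteqP; split => -[a b] /=; tauto.
Qed.

Lemma measurable_Im : measurable_fun setT (@complex.Im R : R[i] -> R).
Proof.
move=> _ B mB; rewrite setTI.
exists (setT `*` B); first exact: measurableX.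
by rewrite setTI; apply/seteqP; split => -[a b] /=; tauto.
Qed.

(** Measurability of both parts, the form that is stable under the arithmetic of
    complex functions. *)
Definition cmeasurable X :=
  measurable_fun setT (fun w => complex.Re (X w)) /\
  measurable_fun setT (fun w => complex.Im (X w)).

Lemma measurable_cmeasurable X : measurable_fun setT X -> cmeasurable X.
Proof.
move=> mX; split; apply: measurableT_comp mX.
- exact: measurable_Re.
- exact: measurable_Im.
Qed.

Lemma measurable_sqrt (h : T -> R) : measurable_fun setT h ->
  measurable_fun setT (fun w => Num.sqrt (h w)).
Proof.
apply: measurableT_comp; apply: continuous_measurable_fun; exact: sqrt_continuous.
Qed.

Lemma cmeasurable_normc X : cmeasurable X ->
  measurable_fun setT (fun w => normc (X w)).
Proof.
move=> [mR mI].
rewrite (_ : (fun w => _) = fun w =>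
  Num.sqrt (complex.Re (X w) ^+ 2 + complex.Im (X w) ^+ 2)).
  apply: measurable_sqrt; apply: measurable_funD; exact: measurable_funX.
by apply/funext => w; case: (X w).
Qed.

Lemma cmeasurable_sum (J : Type) (r : seq J) (X : J -> T -> R[i]) :
  (forall j, cmeasurable (X j)) -> cmeasurable (fun w => \sum_(j <- r) X j w).
Proof.
move=> mX; split.
  under eq_fun do rewrite raddf_sum.
  by apply: measurable_sum => j; case: (mX j).
under eq_fun do rewrite raddf_sum.
by apply: measurable_sum => j; case: (mX j).
Qed.

Lemma cmeasurableZ (s : R[i]) X : cmeasurable X ->
  cmeasurable (fun w => s * X w).
Proof.
move=> [mR mI]; split.
  under eq_fun do rewrite ReM.
  by apply: measurable_funB; apply: measurable_funM.
under eq_fun do rewrite ImM.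
by apply: measurable_funD; apply: measurable_funM.
Qed.

Lemma measurable_wnorm (n d : nat) (u : d.-tuple 'cV[R[i]]_n) (c : 'I_d -> R)
    (X : 'I_n -> T -> R[i]) : (forall i, cmeasurable (X i)) ->
  measurable_fun setT (fun w => wnorm u c (random_vector X w)).
Proof.
move=> mX; apply: measurable_sqrt; apply: measurable_sum => j.
apply: measurable_funM => //; apply: measurable_funX; apply: cmeasurable_normc.
under eq_fun do rewrite hdot_col.
apply: cmeasurable_sum => i; under eq_fun do rewrite mulrC.
exact: cmeasurableZ.
Qed.

End ComplexMeasurability.

(** * Truncation and rounding to a grid *)

Section Truncation.
Context (disp : measure_display) (T : measurableType disp) (R : realType).
Variables (K : R) (X : T -> R[i]).

Lemma ctruncateE w :
  ctruncate K X w = if normc (X w) <= K then X w else 0.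
Proof.
rewrite /ctruncate indicE; case: ifPn => h.
  by rewrite mem_set// rmorph1 mulr1.
by rewrite memNset ?rmorph0 ?mulr0//=; exact/negP.
Qed.

Lemma normc_ctruncate_le w : 0 <= K -> normc (ctruncate K X w) <= K.
Proof.
by move=> K0; rewrite ctruncateE; case: ifPn => // _; rewrite ComplexField.Normc.normc0.
Qed.

Lemma measurable_normc_le : cmeasurable X ->
  measurable [set w | normc (X w) <= K].
Proof.
move=> /cmeasurable_normc mX.
have := measurable_fun_le measurableT mX (measurable_cst K).
by rewrite setTI.
Qed.

Lemma cmeasurable_ctruncate : cmeasurable X -> cmeasurable (ctruncate K X).
Proof.
move=> mX; have mA := measurable_normc_le mX.
have m1 : measurable_fun setT (\1_[set w | normc (X w) <= K] : T -> R).
  exact: measurable_indic.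
have [mR mI] := mX; split.
- rewrite (_ : (fun w => _) =
      (fun w => complex.Re (X w)) \* \1_[set w | normc (X w) <= K]).
    exact: measurable_funM.
  by apply/funext => w; rewrite /ctruncate ReM /= mulr0 subr0.
- rewrite (_ : (fun w => _) =
      (fun w => complex.Im (X w)) \* \1_[set w | normc (X w) <= K]).
    exact: measurable_funM.
  by apply/funext => w; rewrite /ctruncate ImM /= mulr0 add0r.
Qed.

End Truncation.

Section Grid.
Variable R : realType.
Implicit Types s : R[i].

Lemma normRe_le s : `|complex.Re s| <= normc s.
Proof.
case: s => a b /=; rewrite -sqrtr_sqr ler_wsqrtr// lerDl.
exact: sqr_ge0.
Qed.

Lemma normIm_le s : `|complex.Im s| <= normc s.
Proof.
case: s => a b /=; rewrite -sqrtr_sqr ler_wsqrtr// lerDr.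
exact: sqr_ge0.
Qed.

Lemma normc_le_ReIm s : normc s <= `|complex.Re s| + `|complex.Im s|.
Proof.
case: s => a b /=; set m := `|a| + `|b|.
have m0 : 0 <= m by rewrite addr_ge0.
rewrite -[leRHS](ger0_norm m0) -sqrtr_sqr ler_wsqrtr// sqrrD !real_normK ?num_real//.
by rewrite addrAC lerDl mulrn_wge0// mulr_ge0.
Qed.

Section Line.
Variables (K h : R) (N : nat).
Hypothesis h_gt0 : 0 < h.
Hypothesis hN : h * N%:R = 2 * K.

Definition gridpt (a : 'I_N.+1) : R := - K + a%:R * h.

Definition gridcell (a : 'I_N.+1) (x : R) := gridpt a <= x < gridpt a + h.

Lemma gridpt_bound a : `|gridpt a| <= K.
Proof.
rewrite ler_norml /gridpt lerDl mulr_ge0 ?(ltW h_gt0)//=.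
have : a%:R * h <= N%:R * h by rewrite ler_wpM2r ?(ltW h_gt0)// ler_nat -ltnS.
by rewrite [N%:R * h]mulrC hN; lra.
Qed.

Lemma gridcell_cover x : `|x| <= K -> exists a, gridcell a x.
Proof.
rewrite ler_norml => /andP[x1 x2]; set y := (x + K) / h.
have y0 : 0 <= y by rewrite divr_ge0 ?(ltW h_gt0)//; lra.
have yN : y <= N%:R by rewrite ler_pdivrMr// mulrC hN; lra.
have /andP[m1 m2] := truncn_itv y0.
have mN : (Num.truncn y < N.+1)%N.
  by rewrite ltnS -(ler_nat R); exact: le_trans yN.
exists (Ordinal mN); rewrite /gridcell /gridpt /=.
have yh : y * h = x + K by rewrite divfK// gt_eqF.
have := ler_wpM2r (ltW h_gt0) m1.
have : y * h < (Num.truncn y).+1%:R * h by rewrite ltr_pM2r.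
rewrite yh -natr1 mulrDl mul1r => ? ?; apply/andP; split; lra.
Qed.

Lemma gridcell_inj a a' x : gridcell a x -> gridcell a' x -> a = a'.
Proof.
wlog aa' : a a' / (a <= a')%N => [H h1 h2|].
  by case/orP: (leq_total a a') => /H; [exact | move=> /(_ h2 h1)].
move=> /andP[_ h1] /andP[h2 _]; apply/val_inj/eqP.
rewrite eqn_leq aa' /= leqNgt; apply/negP => lt.
have : (a.+1)%:R * h <= a'%:R * h by rewrite ler_wpM2r ?(ltW h_gt0)// ler_nat.
rewrite -natr1 mulrDl mul1r; move: h1 h2; rewrite /gridpt; lra.
Qed.

Lemma gridcell_dist a x : gridcell a x -> `|x - gridpt a| <= h.
Proof. by move=> /andP[h1 h2]; rewrite ger0_norm ?subr_ge0//; lra. Qed.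

End Line.

(** Square half-open cells of side at most eta / 2, selected through the truncated
    point, with the lower left corner of a cell as its representative. The
    truncated points fill the disc of radius K, so the corners stay in the
    square of half-side K, hence within 2 K of the origin. *)
Lemma grid_partition (K eta : R) : 0 < K -> 0 < eta ->
  exists (I : finType) (v : I -> R[i]) (B : I -> set R[i]),
  [/\ forall a, measurable (B a), forall s, exists a, B a s,
      forall a a' s, B a s -> B a' s -> a = a',
      forall a s, B a s -> normc (ctruncate K id s - v a) <= eta
    & forall a, normc (v a) <= 2 * K].
Proof.
move=> K0 eta0; pose N := (Num.truncn (4 * K / eta)).+1.
pose h := 2 * K / N%:R.
have N0 : 0 < N%:R :> R by rewrite ltr0n.
have h0 : 0 < h by rewrite divr_gt0// mulr_gt0.
have hN : h * N%:R = 2 * K by rewrite divfK// gt_eqF.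
have he : 2 * h <= eta.
  have : 4 * K / eta < N%:R by exact: truncnS_gt.
  rewrite ltr_pdivrMr// /h mulrA ler_pdivrMr//; lra.
pose tr := ctruncate K (id : R[i] -> R[i]).
have trK s : normc (tr s) <= K by rewrite normc_ctruncate_le ?ltW.
have [mRe mIm] : cmeasurable tr.
  apply: cmeasurable_ctruncate; split; [exact: measurable_Re|exact: measurable_Im].
exists ('I_N.+1 * 'I_N.+1)%type.
exists (fun a => gridpt K h a.1 +i* gridpt K h a.2).
exists (fun a => [set s | gridcell K h a.1 (complex.Re (tr s)) /\
                          gridcell K h a.2 (complex.Im (tr s))]).
have mcell (f : R[i] -> R) (a : 'I_N.+1) : measurable_fun setT f ->
    measurable [set s | gridcell K h a (f s)].
  move=> mf; rewrite -[X in measurable X]setTI.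
  have := mf measurableT _ (measurable_itv `[gridpt K h a, gridpt K h a + h[).
  by congr (measurable (_ `&` _)); apply/seteqP; split => s /=; rewrite in_itv.
split.
- by move=> a; apply: measurableI; exact: mcell.
- move=> s; have [a1 h1] := gridcell_cover h0 hN (le_trans (normRe_le _) (trK s)).
  have [a2 h2] := gridcell_cover h0 hN (le_trans (normIm_le _) (trK s)).
  by exists (a1, a2).
- move=> [a1 a2] [b1 b2] s /= [h1 h2] [h3 h4].
  by congr (_, _); apply: gridcell_inj; eauto.
- move=> a s [/gridcell_dist h1 /gridcell_dist h2].
  apply: le_trans (normc_le_ReIm _) _.
  rewrite raddfB [complex.Im _]raddfB /=; move: h1 h2; rewrite /tr; lra.
- move=> a; apply: le_trans (normc_le_ReIm _) _ => /=.
  have := gridpt_bound h0 hN a.1; have := gridpt_bound h0 hN a.2; lra.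
Qed.

End Grid.

Section MomentApproximation.
Context (disp : measure_display) (T : measurableType disp) (R : realType).
Variable P : probability T R.
Variables (J I : finType) (A : J -> I -> set T) (v : I -> R[i]).
Hypothesis mA : forall j a, measurable (A j a).
Hypothesis A_cover : forall j w, exists a, A j a w.
Hypothesis A_disj : forall j a a' w, A j a w -> A j a' w -> a = a'.
Variables (j : J) (Y : T -> R[i]) (eta : R).
Hypothesis mY : cmeasurable Y.
Hypothesis Yv : forall a w, A j a w -> normc (Y w - v a) <= eta.

Let p i a := fine (P (A i a)).
Let z (_ : J) a := v a.

Lemma cmean_approx : normc (cmean P Y - dmean p z j) <= 2 * eta.
Proof.
have [mR mI] := mY.
apply: le_trans (normc_le_ReIm _) _.
rewrite raddfB [complex.Im _]raddfB /=.
have h1 : `|fine 'E_P[fun w => complex.Re (Y w)] -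
           \sum_a fine (P (A j a)) * complex.Re (v a)| <= eta.
  apply: expectation_partition (mA j) (A_cover j) (@A_disj j) _ _ _ mR _.
  by move=> a w /Yv; apply: le_trans; rewrite -raddfB; exact: normRe_le.
have h2 : `|fine 'E_P[fun w => complex.Im (Y w)] -
           \sum_a fine (P (A j a)) * complex.Im (v a)| <= eta.
  apply: expectation_partition (mA j) (A_cover j) (@A_disj j) _ _ _ mI _.
  by move=> a w /Yv; apply: le_trans; rewrite -raddfB; exact: normIm_le.
by move: h1 h2; rewrite /p /z; lra.
Qed.

(** The distances of Y and of its rounding to their respective means differ by at
    most eta + 2 eta, and both are at most L + 3 eta. *)
Lemma cvariance_approx (L : R) : (forall w, normc (Y w - cmean P Y) <= L) ->
  `|fine (cvariance P Y) - dvar p z j| <= 3 * eta * (2 * L + 3 * eta).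
Proof.
move=> YL.
apply: expectation_partition (mA j) (A_cover j) (@A_disj j) _ _ _ _ _.
  apply: measurable_funX; apply: cmeasurable_normc; have [mR mI] := mY; split.
    by under eq_fun do rewrite raddfB; exact: measurable_funB.
  by under eq_fun do rewrite raddfB; exact: measurable_funB.
move=> a w /Yv h; set x := normc _; set y := normc _.
have d : normc ((Y w - v a) - (cmean P Y - dmean p z j)) <= 3 * eta.
  apply: le_trans (normcB_le _ _) _; have := cmean_approx.
  by move: h; lra.
have x0 : 0 <= x by exact: normc_ge0.
have y0 : 0 <= y by exact: normc_ge0.
have xL : x <= L by exact: YL.
have xy : x <= y + 3 * eta.
  have -> : x = normc (z j a - dmean p z j +
      ((Y w - v a) - (cmean P Y - dmean p z j))).
    by congr normc; rewrite /z; ring.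
  by apply: le_trans (normcD_le _ _) _; rewrite lerD2l.
have yx : y <= x + 3 * eta.
  have -> : y = normc (Y w - cmean P Y -
      ((Y w - v a) - (cmean P Y - dmean p z j))).
    by congr normc; rewrite /z; ring.
  by apply: le_trans (normcB_le _ _) _; rewrite lerD2l.
have e0 : 0 <= 3 * eta by apply: le_trans d; exact: normc_ge0.
have -> : x ^+ 2 - y ^+ 2 = (x - y) * (x + y) by ring.
rewrite normrM (ger0_norm (addr_ge0 x0 y0)); apply: ler_pM => //.
- exact: addr_ge0.
- by rewrite ler_norml; apply/andP; split; lra.
- by lra.
Qed.

End MomentApproximation.

(** * From rounded to general vectors *)

Lemma measure_bigU_le (disp : measure_display) (T : measurableType disp)
    (R : realType) (P : {measure set T -> \bar R}) (I : Type) (r : seq I)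
    (Q : pred I) (A : I -> set T) : (forall i, measurable (A i)) ->
  (P (\big[setU/set0]_(i <- r | Q i) A i) <= \sum_(i <- r | Q i) P (A i))%E.
Proof.
move=> mA; elim: r => [|i r IH]; first by rewrite !big_nil measure0.
rewrite !big_cons; case: ifP => // _.
apply: le_trans (leeD2l _ IH); apply: measureU2 => //.
exact: bigsetU_measurable.
Qed.

Lemma prodEFin (R : realType) (I : Type) (r : seq I) (Q : pred I) (x : I -> R) :
  (\prod_(i <- r | Q i) (x i)%:E = (\prod_(i <- r | Q i) x i)%:E)%E.
Proof. by elim/big_rec2 : _ => // i a b _ ->; rewrite EFinM. Qed.

Lemma wnorm_dist_le (R : realType) (n d : nat) (u : d.-tuple 'cV[R[i]]_n)
    (c : 'I_d -> R) (x y : 'I_n -> R[i]) (eta : R) :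
  (forall j k : 'I_d, hdot (tnth u j) (tnth u k) = (j == k)%:R) ->
  (forall j, 0 <= c j <= 1) -> 0 <= eta ->
  (forall i, normc (x i - y i) <= eta) ->
  `|wnorm u c (\col_i x i) - wnorm u c (\col_i y i)| <= n%:R * eta.
Proof.
move=> u_on c01 eta0.
have half (a b : 'I_n -> R[i]) : (forall i, normc (a i - b i) <= eta) ->
    wnorm u c (\col_i a i) - wnorm u c (\col_i b i) <= n%:R * eta.
  move=> ab; rewrite lerBlDl.
  apply: le_trans (wnorm_lip u_on c01 _ (\col_i b i)) _; rewrite lerD2l.
  have ne0 : 0 <= n%:R * eta by rewrite mulr_ge0.
  rewrite -[leRHS](ger0_norm ne0) -sqrtr_sqr ler_wsqrtr//.
  apply: (@le_trans _ _ (n%:R * eta ^+ 2)).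
    rewrite -[n in n%:R]card_ord mulr_natl -sumr_const; apply: ler_sum => i _.
    by rewrite !mxE; apply: lerXn2r; rewrite ?nnegrE ?normc_ge0.
  rewrite exprMn ler_wpM2r ?sqr_ge0// expr2; case: (n) => [|m].
    by rewrite mulr0.
  by rewrite ler_peMr// ler1n.
move=> xy; rewrite ler_norml half// andbT lerNl opprB half// => i.
by rewrite normc_distC.
Qed.

Lemma slack_bound (R : realType) (K t e M r ne near dX dZ : R) :
  1 < K -> 64 * K <= t -> e <= M -> 0 <= e -> r + ne <= 1 -> near <= ne ->
  dX <= near + dZ -> t + 4 * M <= dX -> t / 4 + 10 * (4 * K) + (e + r) <= dZ.
Proof. lra. Qed.

Section MainBound.
Context (disp : measure_display) (T : measurableType disp) (R : realType).
Variables (P : probability T R) (n d : nat) (xi : 'I_n -> {RV P >-> R[i]}).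
Hypothesis indep : mutually_independent P (fun i => xi i : T -> R[i]).
Variable K : R.
Hypothesis K1 : 1 < K.
Let X i : T -> R[i] := xi i.
Let e1 := eps1 P K X.
Let e2 := eps2 P K X.
Let e3 := eps3 P K X.
Hypothesis e2_half : e2 <= 1 / 2.
Variables (u : d.-tuple 'cV[R[i]]_n) (c : 'I_d -> R).
Hypothesis u_on : forall j k : 'I_d, hdot (tnth u j) (tnth u k) = (j == k)%:R.
Hypothesis c01 : forall j, 0 <= c j <= 1.

Let dev w := `|wnorm u c (random_vector X w) - Num.sqrt (\sum_j c j)|.

Lemma measurable_deviation (s : R) : measurable [set w | s <= dev w].
Proof.
have mX i : cmeasurable (X i).
  exact/measurable_cmeasurable/measurable_funPT.
have md : measurable_fun setT dev.
  apply: measurableT_comp => //; apply: measurable_funB => //.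
  exact: measurable_wnorm.
by have := measurable_fun_le measurableT (measurable_cst s) md; rewrite setTI.
Qed.

Let Ex i := [set w | K < normc (X i w)].

Let measurable_Ex i : measurable (Ex i).
Proof.
rewrite (_ : Ex i = ~` [set w | normc (X i w) <= K]).
  apply: measurableC; apply: measurable_normc_le.
  exact/measurable_cmeasurable/measurable_funPT.
by apply/seteqP; split => w; rewrite /Ex /= ltNge => /negP.
Qed.

Let e1_le i : (P (Ex i) <= e1%:E)%E.
Proof.
rewrite -[leLHS]fineK; last first.
  exact: fin_num_measure.
by rewrite lee_fin; exact: le_bigmax.
Qed.

Let e2_le i : normc (cmean P (ctruncate K (X i))) <= e2.
Proof. exact: (@le_bigmax _ _ _ 0 (fun i => normc (cmean P (ctruncate K (X i))))). Qed.

Let e3_le i : `|fine (cvariance P (ctruncate K (X i))) - 1| <= e3.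
Proof.
exact: (@le_bigmax _ _ _ 0
  (fun i => `|fine (cvariance P (ctruncate K (X i))) - 1|)).
Qed.

(** The event is covered by the n events |xi_i| > K and by the cylinders, in the
    rounded coordinates, on which the rounded vector already deviates by
    t / 4 + 40 K plus the moment error. The former have total probability at
    most n eps_1, and the cylinders have product probabilities by independence,
    so that [discrete_tail] applies with D = 4 K. Since t >= 64 K, the loss
    3 t / 4 covers 40 K and all rounding errors. *)
Lemma large_deviation_bound (t : R) : 64 * K <= t ->
  (P [set w | (t + 4 * n%:R ^+ 2 * K ^+ 2 * (e2 + e3) <= dev w)%R] <=
    (2 * expR (- (t ^+ 2 / (4096 * K ^+ 2))) + n%:R * e1)%:E)%E.
Proof.
move=> tK.
have K0 : 0 < K by exact: lt_trans K1.
have e20 : 0 <= e2 by exact: bigmax_ge_id.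
have e30 : 0 <= e3 by exact: bigmax_ge_id.
(* The step is chosen so that the total effect of rounding, at most
   n eta (12 K + 12), does not exceed 1. *)
pose eta := (24 * K * n.+1%:R)^-1.
have den0 : 0 < 24 * K * n.+1%:R by rewrite !mulr_gt0.
have eta0 : 0 < eta by rewrite invr_gt0.
have etaK : n%:R * eta * (24 * K) <= 1.
  have nE : n.+1%:R * eta * (24 * K) = 1.
    by rewrite mulrAC [n.+1%:R * _]mulrC mulfV// gt_eqF.
  by rewrite -[leRHS]nE ler_pM2r ?mulr_gt0// ler_pM2r// ler_nat leqnSn.
have eta1 : eta <= 1.
  by rewrite invf_le1// mulr_ege1 ?ler1n//; have := K1; lra.
have [I [v [B [mB B_cover B_inj Bv v_le]]]] := grid_partition K0 eta0.
pose A i a := X i @^-1` B a.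
have mA i a : measurable (A i a).
  have mX : measurable_fun setT (X i) by exact: measurable_funPT.
  by rewrite -[A i a]setTI; exact: mX.
have A_cover i w : exists a, A i a w by exact: B_cover.
have A_disj i a a' w : A i a w -> A i a' w -> a = a' by exact: B_inj.
pose p i a := fine (P (A i a)).
pose z (_ : 'I_n) a := v a.
have p_ge0 i a : 0 <= p i a by exact: fine_ge0.
have p_sum1 i : \sum_a p i a = 1.
  exact: partition_sum1 (mA i) (A_cover i) (A_disj i).
have diam i a a' : normc (z i a - z i a') <= 4 * K.
  apply: le_trans (normcB_le _ _) _.
  have -> : 4 * K = 2 * K + 2 * K by ring.
  by apply: lerD; exact: v_le.
have mY i : cmeasurable (ctruncate K (X i)).
  exact/cmeasurable_ctruncate/measurable_cmeasurable/measurable_funPT.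
have Yv i a w : A i a w -> normc (ctruncate K (X i) w - v a) <= eta.
  by move=> /Bv; rewrite !ctruncateE.
have mean_le i : normc (dmean p z i) <= e2 + 2 * eta.
  have := cmean_approx P mA A_cover A_disj (mY i) (Yv i).
  rewrite -/p -/z => h.
  rewrite -[dmean p z i](subrK (cmean P (ctruncate K (X i)))) addrC.
  apply: le_trans (normcD_le _ _) _; apply: lerD; first exact: e2_le.
  by rewrite normc_distC.
have YL i w : normc (ctruncate K (X i) w - cmean P (ctruncate K (X i))) <= 2 * K.
  apply: le_trans (normcB_le _ _) _.
  have := normc_ctruncate_le (X i) w (ltW K0); have := e2_le i.
  move: e2_half K1; lra.
have var_le i : `|dvar p z i - 1| <= e3 + 3 * eta * (4 * K + 3 * eta).
  have := cvariance_approx mA A_cover A_disj (mY i) (Yv i) (YL i).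
  rewrite -/p -/z => h.
  apply: le_trans (ler_distD (fine (cvariance P (ctruncate K (X i)))) _ _) _.
  by have := e3_le i; rewrite distrC; lra.
set e2' := e2 + 2 * eta in mean_le *; set e3' := e3 + _ in var_le *.
have e2'0 : 0 <= e2' by rewrite addr_ge0 ?mulr_ge0 ?(ltW eta0).
have e3'0 : 0 <= e3'.
  by rewrite addr_ge0 ?mulr_ge0 ?addr_ge0 ?mulr_ge0 ?(ltW eta0) ?(ltW K0).
have K40 : 0 < 4 * K by rewrite mulr_gt0.
have t40 : 0 <= t / 4 by lra.
pose bad (w : {ffun 'I_n -> I}) := t / 4 + 10 * (4 * K) + n%:R * (e2' + e3') <=
  `|wnorm u c (dvec z w) - Num.sqrt (\sum_j c j)|.
have tail := discrete_tail p_ge0 p_sum1 K40 diam u_on c01 mean_le var_le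
  e2'0 e3'0 t40.
pose G (w : {ffun 'I_n -> I}) := \bigcap_(i in [set` finset.setT]) A i (w i).
have mEx i : measurable (Ex i) by exact: measurable_Ex.
have mG w : measurable (G w).
  by apply: fin_bigcap_measurable.
have PG w : P (G w) = (prodw p w)%:E.
  rewrite /G indep// /prodw -prodEFin; apply: eq_big => i; first by rewrite finset.in_setT.
  by move=> _; rewrite fineK ?fin_num_measure.
have cover w : t + 4 * n%:R ^+ 2 * K ^+ 2 * (e2 + e3) <= dev w ->
    (\big[setU/set0]_i Ex i `|` \big[setU/set0]_(a | bad a) G a) w.
  move=> large.
  have [[i wi]|noEx] := pselect (exists i, Ex i w).
    by left; rewrite (bigD1 i)//=; left.
  have [al Aal] := choice (fun i => A_cover i w).
  pose a : {ffun 'I_n -> I} := [ffun i => al i].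
  have Aa i : A i (a i) w by rewrite ffunE.
  have XY i : ctruncate K (X i) w = X i w.
    rewrite ctruncateE ifT// leNgt; apply/negP => h; apply: noEx.
    by exists i.
  have near : `|wnorm u c (random_vector X w) - wnorm u c (dvec z a)| <= n%:R * eta.
    apply: wnorm_dist_le => // [|i]; first exact: ltW.
    by rewrite -XY; exact: Yv.
  have bad_a : bad a.
    have nn : n%:R <= n%:R ^+ 2 * K ^+ 2 :> R.
      have K21 : 1 <= K ^+ 2 by rewrite exprn_ege1// ltW.
      apply: (@le_trans _ _ (n%:R ^+ 2)); last by rewrite ler_peMr ?sqr_ge0.
      by rewrite -natrX ler_nat; case: (n) => // m; rewrite expnS leq_pmulr.
    have nne : n%:R * (e2 + e3) <= n%:R ^+ 2 * K ^+ 2 * (e2 + e3).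
      by rewrite ler_wpM2r ?addr_ge0.
    have nne0 : 0 <= n%:R * (e2 + e3) by rewrite mulr_ge0 ?addr_ge0.
    have ne0 : 0 <= n%:R * eta by rewrite mulr_ge0 ?(ltW eta0).
    have errE : n%:R * (e2' + e3') = n%:R * (e2 + e3) +
        n%:R * eta * (2 + 3 * (4 * K + 3 * eta)).
      by rewrite /e2' /e3'; ring.
    have err : n%:R * eta * (2 + 3 * (4 * K + 3 * eta)) + n%:R * eta <= 1.
      apply: le_trans etaK; rewrite -[X in _ + X]mulr1 -mulrDr ler_wpM2l//; move: eta1 K1; lra.
    have tri := ler_distD (wnorm u c (dvec z a)) (wnorm u c (random_vector X w))
      (Num.sqrt (\sum_j c j)).
    rewrite /bad errE; apply: (slack_bound K1 tK nne nne0 err near tri).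
    by apply: le_trans large; rewrite -!mulrA.
  by right; rewrite (bigD1 a)//=; left => i _; exact: Aa.
apply: (@le_trans _ _ (P (\big[setU/set0]_i Ex i `|`
    \big[setU/set0]_(a | bad a) G a))).
  apply: le_measure; rewrite ?inE//; first exact: measurable_deviation.
  by apply: measurableU; apply: bigsetU_measurable.
apply: le_trans (measureU2 _ _ _) _; [exact: bigsetU_measurable..|].
rewrite EFinD [leRHS]addeC; apply: leeD; last first.
- apply: le_trans (measure_bigU_le _ _ _ mG) _.
  rewrite (eq_bigr (fun a => (prodw p a)%:E)) ?sumEFin ?lee_fin//; last first.
    by move=> a _; exact: PG.
  have -> : t ^+ 2 / (4096 * K ^+ 2) = (t / 4) ^+ 2 / (16 * (4 * K) ^+ 2).
    by field; rewrite gt_eqF.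
  apply: le_trans tail; rewrite big_mkcond; apply: ler_sum => a _.
  by rewrite /bad; case: ifP; rewrite ?mulr1 ?mulr0.
- apply: le_trans (measure_bigU_le _ _ _ mEx) _.
  apply: (@le_trans _ _ (\sum_(i < n) e1%:E)%E).
    by apply: lee_sum => i _; exact: e1_le.
  by rewrite sumEFin lee_fin sumr_const card_ord mulr_natl.
Qed.

End MainBound.

Theorem lemma1p3 (R : realType) :
  exists C C' : R, 0 < C /\ 0 < C' /\
  forall (disp : measure_display) (T : measurableType disp)
    (P : probability T R) (n : nat) (xi : 'I_n -> {RV P >-> R[i]}),
  mutually_independent P (fun i => xi i : T -> R[i]) ->
  (forall i, cintegrable P (xi i)) ->
  (forall i, cmean P (xi i) = 0) ->
  (forall i, cvariance P (xi i) = 1%:E) ->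
  forall K : R, 1 < K ->
  let e1 := eps1 P K (fun i => xi i : T -> R[i]) in
  let e2 := eps2 P K (fun i => xi i : T -> R[i]) in
  let e3 := eps3 P K (fun i => xi i : T -> R[i]) in
  e1 <= 1 / 2 -> e2 <= 1 / 2 -> e3 <= 1 / 2 ->
  forall (d : nat) (H : {vspace 'cV[R[i]]_n}) (u : d.-tuple 'cV[R[i]]_n),
  \dim H = d -> orthonormal_basis H u ->
  forall c : 'I_d -> R, (forall j, 0 <= c j <= 1) ->
  forall t : R, 0 < t ->
  let X := random_vector (fun i => xi i : T -> R[i]) in
  (P [set w | (t + 4 * n%:R ^+ 2 * K ^+ 2 * (e2 + e3) <=
        `| Num.sqrt (\sum_(j < d) c j * normc (hdot (tnth u j) (X w)) ^+ 2)
           - Num.sqrt (\sum_(j < d) c j) |)%R]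
   <= (C * expR (- (C' * (t ^+ 2 / K ^+ 2))) + n%:R * e1)%:E)%E.
Proof.
exists 4, (1 / 4096); split; first by []; split; first by lra.
move=> disp T P n xi indep _ _ _ K K1 e1 e2 e3 _ e2_half _ d H u _ [_ u_on] c c01.
move=> t t0; cbv zeta.
have K0 : 0 < K by exact: lt_trans K1.
have e10 : 0 <= n%:R * e1 by rewrite mulr_ge0//; exact: bigmax_ge_id.
have expE : 1 / 4096 * (t ^+ 2 / K ^+ 2) = t ^+ 2 / (4096 * K ^+ 2).
  by field; rewrite gt_eqF.
rewrite expE; have [tK|Kt] := leP (64 * K) t.
  apply: le_trans (large_deviation_bound indep K1 e2_half u_on c01 tK) _.
  by rewrite lee_fin lerD2r ler_wpM2r ?expR_ge0// ler_nat.
apply: (@le_trans _ _ 1%E).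
  by apply: probability_le1; exact: measurable_deviation.
rewrite lee_fin; apply: (@le_trans _ _ (4 * expR (- 1) + n%:R * e1)); last first.
  rewrite lerD2r; apply: ler_wpM2l => //; rewrite ler_expR lerN2.
  have tK2 : t ^+ 2 <= (64 * K) ^+ 2.
    apply: lerXn2r; rewrite ?nnegrE; last exact: ltW.
      exact: ltW.
    by rewrite mulr_ge0// ltW.
  have sq64 : 4096 = 64 ^+ 2 :> R by rewrite -natrX.
  rewrite sq64 -exprMn ler_pdivrMr ?mul1r//.
  by apply: exprn_gt0; rewrite mulr_gt0.
rewrite -[leLHS]addr0; apply: lerD => //.
by rewrite expRN ler_pdivlMr ?expR_gt0// mul1r expR1_le4.
Qed.
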